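(* Let $(k_n)$ be a good sequence in $\mathbb{N}$ with limit function $c$ and with at most countable spectrum $\Lambda$. (a) For every complex Borel measure $\mu$ on $\mathbb{T}$, $$\lim_{N\to\infty}\frac1N\sum_{n=1}^N|\widehat\mu(k_n)|^2=\sum_{\lambda\in\Lambda}c(\lambda)\sum_{a\text{ atom}}\overline\mu(\{a\overline\lambda\})\,\mu(\{a\}).$$ In particular, for every continuous complex Borel measure $\mu$ on $\mathbb{T}$, $$\lim_{N\to\infty}\frac1N\sum_{n=1}^N|\widehat\mu(k_n)|^2=0.$$ (b) For every Borel probability measure $\mu$ on $\mathbb{T}$, $$\lim_{N\to\infty}\frac1N\sum_{n=1}^N|\widehat\mu(k_n)|^2\le\sum_{a\in U}\mu(a\langle\Lambda\rangle)^2,$$ where $U$ is a maximal set of $\Lambda$-independent atoms. Equality holds here if and only if $\mu$ satisfies $c(a\overline b)=1$ for all atoms $a,b$ of $\mu$ (but $\mu$ may not necessarily be discrete).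
   Context: $\mathbb{T}$ is the unit circle in $\mathbb{C}$, $\mathbb{N}=\{1,2,\dots\}$; a sequence in $\mathbb{N}$ here is a function $k:\mathbb{N}\to\mathbb{N}$ that is strictly increasing for sufficiently large indices. $(k_n)$ is good if $c(\lambda):=\lim_{N\to\infty}\frac1N\sum_{n=1}^N\lambda^{k_n}$ exists for every $\lambda\in\mathbb{T}$; its spectrum is $\Lambda=\{\lambda\in\mathbb{T}:c(\lambda)\ne0\}$. $\langle\Lambda\rangle$ is the subgroup of $\mathbb{T}$ generated by $\Lambda$. Two elements $\lambda_1,\lambda_2\in\mathbb{T}$ are $\Lambda$-dependent if $\lambda_1\langle\Lambda\rangle=\lambda_2\langle\Lambda\rangle$, and $\Lambda$-independent otherwise. $\widehat\mu(k)=\int_{\mathbb{T}}z^k\,\mathrm{d}\mu(z)$, $\overline\mu$ is the complex conjugate measure, an atom of $\mu$ is a point $a\in\mathbb{T}$ with $\mu(\{a\})\ne0$, and $\mu$ is continuous if it has no atoms.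
   Formalization: In the equality case of (b), c(a b̄)=1 is required only for Λ-dependent atoms a, b; for all atoms the ''only if'' fails, e.g. for k_n = n and μ = (δ_1+δ_{-1})/2, where equality holds but c(-1)=0. *)

(* Defs.v *)
From HB Require Import structures.
From mathcomp Require Import all_boot all_order all_algebra.
From mathcomp Require Import complex.
From mathcomp Require Import all_classical all_reals all_analysis.
From mathcomp Require Import summability.

Set Implicit Arguments.
Unset Strict Implicit.
Unset Printing Implicit Defensive.

Import Order.TTheory GRing.Theory Num.Theory.
Import numFieldNormedType.Exports.

Local Open Scope classical_set_scope.
Local Open Scope ring_scope.

(* R[i], packaged as a numClosedFieldType so that it inherits the topology and
   norm that numFieldNormedType attaches to every such structure. *)
Definition C (R : realType) : numClosedFieldType := R[i].

Definition reC (R : realType) (z : C R) : R := complex.Re z.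
Definition imC (R : realType) (z : C R) : R := complex.Im z.
Definition ofR (R : realType) (x : R) : C R := real_complex R x.
Definition mkC (R : realType) (x y : R) : C R := Complex x y.

Section coordinates.
Context (R : realType).

Let reC_additive : {morph @reC R : x y / x - y}.
Proof. by move=> [a b] [c d]. Qed.

Let imC_additive : {morph @imC R : x y / x - y}.
Proof. by move=> [a b] [c d]. Qed.

Let ofR_additive : {morph @ofR R : x y / x - y}.
Proof. by move=> x y; rewrite /ofR rmorphB. Qed.

HB.instance Definition _ := GRing.isZmodMorphism.Build _ _ (@reC R) reC_additive.
HB.instance Definition _ := GRing.isZmodMorphism.Build _ _ (@imC R) imC_additive.
HB.instance Definition _ := GRing.isZmodMorphism.Build _ _ (@ofR R) ofR_additive.

Let norm_ofR (x : R) : `|ofR x| = ofR `|x|.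
Proof. by rewrite /ofR normc_def /= expr0n /= addr0 sqrtr_sqr. Qed.

Let ltr_ofR (x y : R) : (ofR x < ofR y) = (x < y).
Proof. by rewrite /ofR ltcR. Qed.

Lemma norm_reC (z : C R) : ofR `|reC z| <= `|z|.
Proof. exact: normc_ge_Re. Qed.

Lemma norm_imC (z : C R) : ofR `|imC z| <= `|z|.
Proof.
case: z => a b; rewrite normc_def /ofR /= lecR -sqrtr_sqr ler_wsqrtr//.
by rewrite lerDr sqr_ge0.
Qed.

Lemma reC_continuous : continuous (@reC R).
Proof.
move=> z; apply/(@cvgrPdist_lt _ _ _ (nbhs z) (nbhs_filter z)) => e e0.
have E0 : 0 < ofR e by rewrite -[0]/(ofR 0) ltr_ofR.
apply/nbhs_ballP; exists (ofR e) => //= w; rewrite -ball_normE/= => zw.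
rewrite -raddfB -ltr_ofR; exact: (le_lt_trans (norm_reC _)).
Qed.

Lemma imC_continuous : continuous (@imC R).
Proof.
move=> z; apply/(@cvgrPdist_lt _ _ _ (nbhs z) (nbhs_filter z)) => e e0.
have E0 : 0 < ofR e by rewrite -[0]/(ofR 0) ltr_ofR.
apply/nbhs_ballP; exists (ofR e) => //= w; rewrite -ball_normE/= => zw.
rewrite -raddfB -ltr_ofR; exact: (le_lt_trans (norm_imC _)).
Qed.

Lemma ofR_continuous : continuous (@ofR R).
Proof.
move=> x; apply/cvgrPdist_lt => e e0.
have [r r0 re] : exists2 r : R, 0 < r & ofR r = e.
  case: e e0 => a b; rewrite -[0]/(ofR 0) /ofR ltcE /= => /andP[/eqP b0 a0].
  by exists a => //; rewrite b0.
apply/nbhs_ballP; exists r => //= y xy.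
by rewrite -raddfB norm_ofR -re ltr_ofR.
Qed.

End coordinates.

Section charge_map.
Context d (T : measurableType d) (K1 K2 : numFieldType).
Variables (h : {additive K1 -> K2}) (mu : {charge set T -> \bar K1}).

Definition charge_map & continuous h : set T -> \bar K2 :=
  fun A => (h (fine (mu A)))%:E.

Variable hc : continuous h.
Local Notation nu := (charge_map hc).

Let nu_fin : fin_num_fun nu.
Proof. by []. Qed.

HB.instance Definition _ := isFinite.Build _ _ _ nu nu_fin.

Let fine_sumE (F : nat -> set T) n : (forall k, measurable (F k)) ->
  (\sum_(0 <= k < n) mu (F k))%E = (\sum_(0 <= k < n) fine (mu (F k)))%:E.
Proof.
move=> mF; rewrite -sumEFin; apply: eq_bigr => k _.
by rewrite fineK//; exact: fin_num_measure.
Qed.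

Let nu_additive : measure_function.semi_additive nu.
Proof.
move=> F n mF tF mU; rewrite /charge_map charge_semi_additive//.
by rewrite -(big_mkord xpredT (fun i => mu (F i))) fine_sumE//= raddf_sum
  sumEFin big_mkord.
Qed.

HB.instance Definition _ := isAdditiveCharge.Build _ _ _ nu nu_additive.

Let nu_sigma_additive : semi_sigma_additive nu.
Proof.
move=> F mF tF mU.
have := @charge_semi_sigma_additive _ _ _ mu F mF tF mU.
rewrite -(@fineK _ (mu (\bigcup_n F n))); last exact: fin_num_measure.
move=> H P /= /nbhs_EFin /= /hc/= /(fun V => H (fun x => P (h (fine x))%:E) V).
rewrite /= !nbhs_simpl/=; apply: filterS => n /=.
by rewrite fine_sumE//= raddf_sum /charge_map -sumEFin.
Qed.

HB.instance Definition _ := isSemiSigmaAdditive.Build _ _ _ nu nu_sigma_additive.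

End charge_map.

(* A complex measure is a countably additive C-valued set function: this is
   [{charge set T -> \bar (C R)}], charges being finite on measurable sets. *)
Section complex_integral.
Context d (T : measurableType d) (R : realType).

Definition re_charge (mu : {charge set T -> \bar (C R)}) : {charge set T -> \bar R} :=
  charge_map mu (@reC_continuous R).

Definition im_charge (mu : {charge set T -> \bar (C R)}) : {charge set T -> \bar R} :=
  charge_map mu (@imC_continuous R).

Definition complex_charge (mu : probability T R) : {charge set T -> \bar (C R)} :=
  charge_map (charge_of_finite_measure mu) (@ofR_continuous R).

(* Integral against a signed measure, through its Jordan decomposition (which
   does not depend on the Hahn decomposition that is picked). *)
Definition charge_integral (nu : {charge set T -> \bar R}) (g : T -> R) : R :=
  let: exist _ exN := cid (Hahn_decomposition nu) in
  let: exist _ nuPN := cid exN in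
  Rintegral (jordan_pos nuPN) setT g - Rintegral (jordan_neg nuPN) setT g.

Definition complex_integral (mu : {charge set T -> \bar (C R)}) (f : T -> C R) : C R :=
  mkC
    (charge_integral (re_charge mu) (fun x => reC (f x)) -
     charge_integral (im_charge mu) (fun x => imC (f x)))
    (charge_integral (re_charge mu) (fun x => imC (f x)) +
     charge_integral (im_charge mu) (fun x => reC (f x))).

Definition atoms (K : numFieldType) (mu : set T -> \bar K) : set T :=
  [set a | mu [set a] != 0%E].

Definition continuous_charge (K : numFieldType) (mu : set T -> \bar K) : Prop :=
  atoms mu = set0.

Definition discrete (mu : probability T R) : Prop :=
  exists2 A : set T, countable A & mu (~` A) = 0%E.

Definition conj_charge (mu : set T -> \bar (C R)) : set T -> \bar (C R) :=
  fun A => ((fine (mu A))^*)%:E.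

End complex_integral.

Definition circle (R : realType) : Type := [set z : C R | `|z| = 1].

Section circle_structures.
Context (R : realType).
Local Notation T := (circle R).

HB.instance Definition _ := Choice.on T.
HB.instance Definition _ := Topological.on T.

Definition circle_val (z : T) : C R := set_val z.

Lemma circle_norm (z : T) : `|circle_val z| = 1.
Proof. exact: set_valP z. Qed.

Definition circle_of (z : C R) (z1 : `|z| = 1) : T := exist _ z (mem_set z1).

Let norm_mul (z w : T) : `|circle_val z * circle_val w| = 1.
Proof. by rewrite normrM !circle_norm mulr1. Qed.

Let norm_conj (z : T) : `|(circle_val z)^*| = 1.
Proof. by rewrite norm_conjC circle_norm. Qed.

Definition circle_one : T := circle_of (normr1 (C R)).
Definition circle_mul (z w : T) : T := circle_of (norm_mul z w).
Definition circle_conj (z : T) : T := circle_of (norm_conj z).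

Lemma circle_valP : injective circle_val.
Proof. exact: val_inj. Qed.

Let circle_mulA : associative circle_mul.
Proof. by move=> x y z; apply: circle_valP; exact: mulrA. Qed.

Let circle_mul1 : left_id circle_one circle_mul.
Proof. by move=> x; apply: circle_valP; exact: mul1r. Qed.

Let circle_mulr1 : right_id circle_one circle_mul.
Proof. by move=> x; apply: circle_valP; exact: mulr1. Qed.

Let circle_mulV : left_inverse circle_one circle_conj circle_mul.
Proof.
move=> x; apply: circle_valP.
change ((circle_val x)^* * circle_val x = 1).
by rewrite mulrC -normCK circle_norm expr1n.
Qed.

Let circle_mulrV : right_inverse circle_one circle_conj circle_mul.
Proof.
move=> x; apply: circle_valP.
change (circle_val x * (circle_val x)^* = 1).
by rewrite -normCK circle_norm expr1n.
Qed.

(* The group inverse on the circle is complex conjugation by definition, so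
   [a * b^-1] below is the product of a and the conjugate of b. *)
HB.instance Definition _ := isGroup.Build T
  circle_mulA circle_mul1 circle_mulr1 circle_mulV circle_mulrV.

HB.instance Definition _ := isPointed.Build T circle_one.
HB.instance Definition _ :=
  Measurable.copy T (g_sigma_algebraType (@open T)).

End circle_structures.

Section subgroups.
Context (R : realType).
Local Notation T := (circle R).
Local Open Scope group_scope.

Definition is_subgroup (H : set T) : Prop :=
  [/\ H 1, forall x y, H x -> H y -> H (x * y) & forall x, H x -> H x^-1].

Definition generated (L : set T) : set T := smallest is_subgroup L.

Definition coset (a : T) (H : set T) : set T := [set a * h | h in H].

Definition dependent (L : set T) (a b : T) : Prop :=
  coset a (generated L) = coset b (generated L).

Definition independent_atoms (L : set T) (mu : probability T R) (U : set T) : Prop :=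
  U `<=` atoms mu /\
  forall a b, U a -> U b -> a <> b -> ~ dependent L a b.

Definition max_independent_atoms (L : set T) (mu : probability T R) (U : set T) : Prop :=
  independent_atoms L mu U /\
  forall V, independent_atoms L mu V -> U `<=` V -> V = U.

End subgroups.

Section sequences.
Context (R : realType).
Local Notation T := (circle R).

Definition average (u : nat -> C R) (N : nat) : C R :=
  N%:R^-1 * \sum_(1 <= n < N.+1) u n.

(* The index set is {1, 2, ...}; the value at 0 is never used. *)
Definition sequence_in_N (k : nat -> nat) : Prop :=
  (forall n, (0 < n)%N -> (0 < k n)%N) /\ \forall n \near \oo, (k n < k n.+1)%N.

Definition good (k : nat -> nat) : Prop :=
  sequence_in_N k /\
  forall z : T, cvgn (average (fun n => circle_val z ^+ k n)).

Definition limit_function (k : nat -> nat) (z : T) : C R :=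
  limn (average (fun n => circle_val z ^+ k n)).

Definition spectrum (k : nat -> nat) : set T :=
  [set z | limit_function k z != 0].

Definition fourier (mu : {charge set T -> \bar (C R)}) (k : nat) : C R :=
  complex_integral mu (fun z => circle_val z ^+ k).

Definition fourier_average (mu : {charge set T -> \bar (C R)}) (k : nat -> nat) :
    nat -> C R :=
  average (fun n => `|fourier mu (k n)| ^+ 2).

(* Unordered sums over a set D: limits along the net of finite subsets. *)
Definition csummable (D : set T) (f : T -> C R) : Prop :=
  cvg (partial_sum (f \_ D) @ totally).

Definition csum (D : set T) (f : T -> C R) : C R :=
  lim (partial_sum (f \_ D) @ totally).

Definition atom_term (mu : {charge set T -> \bar (C R)}) (l a : T) : C R :=
  fine (conj_charge mu [set (a * l^-1)%g]) * fine (mu [set a]).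

End sequences.

Arguments spectrum : clear implicits.

(* Main.v *)
(* Let c be the limit function, with countable support Lambda.  For fixed z,
   bounded convergence shows that the averages of z^(k_n) conj(mu^(k_n)) tend to
   G(z) = conj(int c(z^-1 w) dmu(w)); a second bounded convergence, now against
   mu, shows that the averages of |mu^(k_n)|^2 tend to int G dmu, so no product
   measure is needed.  Since c is supported on Lambda,
   G(z) = sum_{l in Lambda} c(l) conj(mu{z l^-1}), and integrating term by term
   gives the double sum; the masses of the atoms are absolutely summable, which
   makes every unordered sum converge.

   For (b), let H be the group generated by Lambda.  The right-hand side is
   int mu(zH) dmu(z), so that the gap in the inequality is the double integral of
   1_{zH}(w) - Re c(z^-1 w).  This kernel is nonnegative, because c vanishes off H
   and |c| <= 1, and for fixed z it is supported on the countable set zH, so its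
   double integral is zero iff it vanishes at all pairs of atoms.  The non-discrete
   example is atomless: the image of the uniform law on [0, 1] under the
   injection t |-> (1 + i t) / (1 - i t). *)
From HB Require Import structures.
Require Import Defs.
From mathcomp Require Import all_boot all_order all_algebra finmap complex.
From mathcomp Require Import all_classical all_reals all_analysis.
From mathcomp Require Import measurable_realfun summability ring lra.

Import Order.TTheory GRing.Theory Num.Theory.
Import numFieldNormedType.Exports.
Local Open Scope classical_set_scope.
Local Open Scope ring_scope.
Set Implicit Arguments.
Unset Strict Implicit.
Unset Printing Implicit Defensive.

(** * Complex numbers over a real field *)

Section complex_numbers.
Context {R : realType}.
Implicit Types (z w : C R) (x y : R).

Lemma C_eqP z w : reC z = reC w -> imC z = imC w -> z = w.
Proof. by case: z w => [a b] [c d] /= -> ->. Qed.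

Lemma reC_mkC x y : reC (mkC x y) = x. Proof. by []. Qed.
Lemma reC_ofR x : reC (ofR x) = x. Proof. by []. Qed.
Lemma imC_ofR x : imC (ofR x) = 0. Proof. by []. Qed.

Lemma reCM z w : reC (z * w) = reC z * reC w - imC z * imC w.
Proof. by case: z w => [a b] [c d]. Qed.

Lemma imCM z w : imC (z * w) = reC z * imC w + imC z * reC w.
Proof. by case: z w => [a b] [c d]. Qed.

Lemma reC_conj z : reC z^* = reC z. Proof. by case: z. Qed.
Lemma imC_conj z : imC z^* = - imC z. Proof. by case: z. Qed.

Lemma ofRM x y : ofR (x * y) = ofR x * ofR y.
Proof. by rewrite /ofR rmorphM. Qed.

Lemma ler_ofR x y : (ofR x <= ofR y) = (x <= y).
Proof. by rewrite /ofR lecR. Qed.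

Lemma ltr_ofR x y : (ofR x < ofR y) = (x < y).
Proof. by rewrite /ofR ltcR. Qed.

(** The norm of [C R] is itself [C R]-valued. Bounds, suprema and real integrals need it as an
    element of [R]. *)
Definition normR z : R := reC `|z|.

Lemma ofR_normR z : ofR (normR z) = `|z|.
Proof. by rewrite /normR normc_def. Qed.

Lemma normR_ge0 z : 0 <= normR z.
Proof. by rewrite -ler_ofR ofR_normR; exact: normr_ge0. Qed.

Lemma normR0 : normR 0 = 0.
Proof. by rewrite /normR normr0. Qed.

Lemma normRM z w : normR (z * w) = normR z * normR w.
Proof.
by apply: (can_inj reC_ofR); rewrite ofRM !ofR_normR normrM.
Qed.

Lemma normR_conj z : normR z^* = normR z.
Proof. by rewrite /normR norm_conjC. Qed.

Lemma normRD z w : normR (z + w) <= normR z + normR w.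
Proof. by rewrite -ler_ofR raddfD /= !ofR_normR; exact: ler_normD. Qed.

Lemma normR_sum I (r : seq I) (P : pred I) (F : I -> C R) :
  normR (\sum_(i <- r | P i) F i) <= \sum_(i <- r | P i) normR (F i).
Proof.
rewrite -ler_ofR ofR_normR raddf_sum /=.
under [leRHS]eq_bigr do rewrite ofR_normR.
exact: ler_norm_sum.
Qed.

Lemma abs_reC_le z : `|reC z| <= normR z.
Proof. by rewrite -ler_ofR ofR_normR; exact: norm_reC. Qed.

Lemma abs_imC_le z : `|imC z| <= normR z.
Proof. by rewrite -ler_ofR ofR_normR; exact: norm_imC. Qed.

Lemma C_reim z : z = ofR (reC z) + mkC 0 1 * ofR (imC z).
Proof.
by apply: C_eqP; rewrite raddfD /= ?reCM ?imCM /=; ring.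
Qed.

Lemma normR_ofR x : normR (ofR x) = `|x|.
Proof. by rewrite /normR /ofR normc_def /= expr0n /= addr0 sqrtr_sqr. Qed.

Lemma normR_le_reim z : normR z <= `|reC z| + `|imC z|.
Proof.
have Ei : normR (mkC 0 1) = 1.
  by rewrite /normR normc_def /= expr0n /= add0r expr1n sqrtr1.
by rewrite {1}[z]C_reim (le_trans (normRD _ _))// normRM Ei mul1r !normR_ofR.
Qed.

Lemma cvg_reim {T : Type} {F : set_system T} {FF : Filter F} (f : T -> C R) (l : C R) :
  (fun t => reC (f t)) @ F --> reC l -> (fun t => imC (f t)) @ F --> imC l ->
  f @ F --> l.
Proof.
move=> re im; rewrite [l]C_reim.
under eq_cvg => t do rewrite [f t]C_reim.
apply: cvgD.
- exact: (cvg_comp _ _ re (@ofR_continuous R (reC l))).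
- apply: cvgM; first exact: cvg_cst.
  exact: (cvg_comp _ _ im (@ofR_continuous R (imC l))).
Qed.

Lemma cvg_reC {T : Type} {F : set_system T} {FF : Filter F} (f : T -> C R) (l : C R) :
  f @ F --> l -> (fun t => reC (f t)) @ F --> reC l.
Proof. by move=> fl; exact: (cvg_comp _ _ fl (@reC_continuous R l)). Qed.

Lemma cvg_imC {T : Type} {F : set_system T} {FF : Filter F} (f : T -> C R) (l : C R) :
  f @ F --> l -> (fun t => imC (f t)) @ F --> imC l.
Proof. by move=> fl; exact: (cvg_comp _ _ fl (@imC_continuous R l)). Qed.

Lemma cvg_conj {T : Type} {F : set_system T} {FF : Filter F} (f : T -> C R) (l : C R) :
  f @ F --> l -> (fun t => (f t)^* : C R) @ F --> (l^* : C R).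
Proof.
move=> fl; apply: cvg_reim.
- under eq_cvg => t do rewrite reC_conj.
  by rewrite reC_conj; exact: cvg_reC.
- under eq_cvg => t do rewrite imC_conj.
  by rewrite imC_conj; apply: cvgN; exact: cvg_imC.
Qed.

Lemma cvg_normR {T : Type} {F : set_system T} {FF : Filter F} (f : T -> C R) (l : C R) :
  f @ F --> l -> (fun t => normR (f t)) @ F --> normR l.
Proof. by move=> fl; apply: cvg_reC; exact: cvg_norm. Qed.

Lemma ofR_pos_inv (e : C R) : 0 < e -> exists2 r : R, 0 < r & ofR r = e.
Proof.
case: e => a b; rewrite -[0]/(ofR 0) /ofR ltcE /= => /andP[/eqP b0 a0].
by exists a => //; rewrite b0.
Qed.

(** A positive element of [C R] is [ofR r] for a real [r > 0], so real tolerances suffice. *)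
Lemma cvg_normRP {T : Type} {F : set_system T} {FF : Filter F} (f : T -> C R) (l : C R) :
  f @ F --> l <-> (forall e : R, 0 < e -> \forall t \near F, normR (l - f t) < e).
Proof.
split=> [/cvgrPdist_lt fl e e0|fl].
  have := fl (ofR e); rewrite -[0]/(ofR 0) ltr_ofR => /(_ e0).
  by apply: filterS => t; rewrite -ofR_normR ltr_ofR.
apply/cvgrPdist_lt => _ /ofR_pos_inv[r r0 <-].
by have := fl r r0; apply: filterS => t; rewrite -ofR_normR ltr_ofR.
Qed.

End complex_numbers.

(** * Unordered sums over countable sets *)

Section exhaustions.
Context {T : choiceType}.
Implicit Types (D : set T) (F : nat -> {fset T}).
Local Open Scope fset_scope.

(** Increasing finite sets with union [D]. They replace the net of finite subsets by a sequence, to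
    which bounded convergence applies. *)
Definition exhausts D F : Prop :=
  [/\ forall m n, (m <= n)%N -> F m `<=` F n,
      forall n x, x \in F n -> D x &
      forall x, D x -> exists n, x \in F n].

Lemma countable_exhausts D : countable D -> exists F, exhausts D F.
Proof.
move=> /countable_injP[f finj].
pose P n := [set x | D x /\ (f x <= n)%N].
have fin n : finite_set (P n).
  have inj : {in P n &, injective f}.
    by move=> x y /set_mem[Dx _] /set_mem[Dy _]; apply: finj; exact: mem_set.
  have /card_eqPle[_ le] := inj_card_eq inj.
  apply: (card_le_finite le); apply: (sub_finite_set _ (finite_II n.+1)).
  by move=> _ [x [_ xn] <-]; rewrite /= ltnS.
exists (fun n => fset_set (P n)); split.
- move=> m n mn; apply/fsubsetP => x; rewrite !in_fset_set// !inE => -[Dx xm].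
  by split => //; exact: leq_trans mn.
- by move=> n x; rewrite in_fset_set// inE => -[].
- by move=> x Dx; exists (f x); rewrite in_fset_set// inE; split => /=.
Qed.

Lemma exhausts_fset D F (A : {fset T}) : exhausts D F ->
  (forall x, x \in A -> D x) -> exists n, A `<=` F n.
Proof.
move=> [Fm _ Fc]; elim/finSet_rect: A => A IH AD.
have [->|[a aA]] := fset_0Vmem A; first by exists 0%N; rewrite fsub0set.
have [||n An] := IH (A `\ a).
- by rewrite fproperD1.
- by move=> x; rewrite in_fsetD1 => /andP[_]; exact: AD.
have [m am] := Fc _ (AD _ aA).
exists (maxn n m); apply/fsubsetP => x xA.
have [->|xa] := eqVneq x a; first by apply: (fsubsetP (Fm _ _ (leq_maxr n m))).
by apply/(fsubsetP (Fm _ _ (leq_maxl n m)))/(fsubsetP An); rewrite in_fsetD1 xa.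
Qed.

Lemma ler_sum_fsubset (R : realType) (A B : {fset T}) (f : T -> R) :
  A `<=` B -> (forall x, 0 <= f x) -> \sum_(x <- A) f x <= \sum_(x <- B) f x.
Proof.
move=> AB f0; rewrite [leRHS](big_fsetID _ (mem A))/=.
rewrite (_ : [fset x in B | x \in A] = A) ?lerDl ?sumr_ge0//.
apply/fsetP => x; rewrite !inE/=.
by apply: andb_idl => xA; exact: (fsubsetP AB).
Qed.

End exhaustions.

Section unordered_sums.
Context {R : realType} {T : choiceType}.
Implicit Types (D : set T) (f : T -> C R) (s : C R).
Local Open Scope fset_scope.

#[export] Existing Instance totally_filter.

Definition has_sum D f s : Prop := partial_sum (f \_ D)%R @ totally --> s.

Lemma partial_sumE (f : T -> C R) (A : {fset T}) :
  partial_sum f A = \sum_(x <- A) f x.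
Proof. by rewrite /partial_sum big_seq_fsetE. Qed.

Lemma has_sum_lim D f s : has_sum D f s -> lim (partial_sum (f \_ D)%R @ totally) = s.
Proof. by move=> h; apply: cvg_lim. Qed.

Lemma eq_has_sum D f g s : (forall x, D x -> f x = g x) ->
  has_sum D f s -> has_sum D g s.
Proof.
move=> fg; rewrite /has_sum (_ : (f \_ D)%R = (g \_ D)%R)//.
by apply/funext => x; rewrite /patch; case: ifPn => // /set_mem; exact: fg.
Qed.

Lemma has_sum0 D f : (forall x, D x -> f x = 0) -> has_sum D f 0.
Proof.
move=> f0; apply: (@eq_has_sum D (fun=> 0)) => [x /f0//|].
rewrite /has_sum (_ : partial_sum _ = fun=> 0); first exact: cvg_cst.
apply/funext => A; rewrite partial_sumE big1// => x _.
by rewrite /patch; case: ifP.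
Qed.

(** The bound [M] on sums of norms gives absolute summability: what any finite set adds to [F n] is
    at most a tail of a convergent series of norms. Convergence along one exhaustion therefore
    forces convergence along the whole net. *)
Lemma has_sum_exhausts D F f s (M : R) : exhausts D F ->
  (forall A : {fset T}, (forall x, x \in A -> D x) ->
    \sum_(x <- A) normR (f x) <= M) ->
  (fun n => \sum_(x <- F n) f x) @ \oo --> s -> has_sum D f s.
Proof.
move=> DF fM fs.
have [Fm FD _] := DF.
pose u n := \sum_(x <- F n) normR (f x).
have u_nd : nondecreasing_seq u.
  by move=> m n mn; apply: ler_sum_fsubset; [exact: Fm|move=> x; exact: normR_ge0].
have u_ub : has_ubound (range u).
  by exists M => _ [n _ <-]; apply: fM => x; exact: FD.
have u_cvg := nondecreasing_is_cvgn u_nd u_ub.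
apply/cvg_normRP => e e0.
have e20 : 0 < e / 2 by rewrite divr_gt0.
have [n [un sn]] : exists n, limn u - u n < e / 2 /\ normR (s - \sum_(x <- F n) f x) < e / 2.
  near \oo => n; exists n; split; near: n; last exact: (@cvg_normRP _ _ _ _ _ _).1.
  move/cvgrPdist_lt: u_cvg => /(_ _ e20).
  by apply: filterS => n; apply: le_lt_trans; exact: ler_norm.
(* Every finite [A] containing [F n] must have its sum within [e] of [s]. Only its part [A'] inside
   [D] matters. As [A'] lies in some [F m], the norms over [A'] outside [F n] sum to at most
   [u m - u n], hence to less than [e / 2]. *)
exists (F n) => // A/= FA.
rewrite partial_sumE (_ : \sum_(x <- A) _ = \sum_(x <- [fset x in A | x \in D]) f x); last first.
  rewrite [LHS](big_fsetID _ (mem D))/= [X in (_ + X)%R]big1_fset ?addr0; last first.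
    by move=> x; rewrite !inE/= => /andP[_] /negbTE xD _; rewrite /patch xD.
  apply: eq_fbigr => x; rewrite !inE/= => /andP[_ xD] _; by rewrite /patch xD.
set A' := [fset x in A | x \in D].
have FA' : F n `<=` A'.
  apply/fsubsetP => x xF; rewrite !inE/= (fsubsetP FA)//=.
  by apply/mem_set; exact: FD xF.
have [m A'm] : exists m, A' `<=` F m.
  by apply: (exhausts_fset DF) => x; rewrite !inE/= => /andP[_ /set_mem].
have split_sum (V : zmodType) (h : T -> V) :
    (\sum_(x <- A') h x = \sum_(x <- F n) h x + \sum_(x <- [fset x in A' | x \notin F n]) h x)%R.
  rewrite [LHS](big_fsetID _ (mem (F n)))/=; congr (_ + _)%R.
  apply: eq_fbigl => x; rewrite !inE/=.
  by apply: andb_idl => xF; have := fsubsetP FA' _ xF; rewrite !inE.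
rewrite (split_sum (C R)) opprD addrA (le_lt_trans (normRD _ _))//.
rewrite [ltRHS]splitr ltrD//.
rewrite /normR normrN -/(normR _) (le_lt_trans (normR_sum _ _ _))//.
apply: le_lt_trans un.
have -> : \sum_(x <- [fset x in A' | x \notin F n]) normR (f x)
    = \sum_(x <- A') normR (f x) - u n.
  by rewrite (split_sum R) addrC /u addKr.
rewrite lerB// (le_trans _ (nondecreasing_cvgn_le u_nd u_cvg m))//.
by apply: ler_sum_fsubset => // x; exact: normR_ge0.
Unshelve. all: end_near. Qed.

(** A uniform bound on finite rectangles of a double family passes to the limit in one variable.
    This gives absolute summability of the outer sum over the spectrum. *)
Lemma has_sum_normR_le I (B : seq I) D (f : I -> T -> C R) (s : I -> C R) (M : R) :
  (forall i, has_sum D (f i) (s i)) ->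
  (forall A : {fset T}, \sum_(i <- B) \sum_(x <- A) normR (f i x) <= M) ->
  \sum_(i <- B) normR (s i) <= M.
Proof.
move=> fs fM.
have cv : (fun A => \sum_(i <- B) normR (partial_sum (f i \_ D)%R A)) @ totally
    --> \sum_(i <- B) normR (s i).
  elim: B {fM} => [|i B IH].
    under eq_cvg => A do rewrite big_nil.
    by rewrite big_nil; exact: cvg_cst.
  under eq_cvg => A do rewrite big_cons.
  by rewrite big_cons; apply: cvgD => //; apply: cvg_normR; exact: fs.
apply: (cvgr_to_le cv); apply: nearW => A.
apply: le_trans (fM A); apply: ler_sum => i _.
rewrite partial_sumE (le_trans (normR_sum _ _ _))//; apply: ler_sum => x _.
by rewrite /patch; case: ifP => // _; rewrite normR0 normR_ge0.
Qed.

Lemma esum_exhausts D F (f : T -> R) (s : R) : exhausts D F ->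
  (forall x, 0 <= f x) -> (fun n => \sum_(x <- F n) f x) @ \oo --> s ->
  (\esum_(x in D) (f x)%:E)%E = s%:E.
Proof.
move=> DF f0 fs; have [Fm FD _] := DF.
have u_nd : nondecreasing_seq (fun n => \sum_(x <- F n) f x).
  by move=> m n mn; apply: ler_sum_fsubset => //; exact: Fm.
have sumE (A : {fset T}) : (\sum_(x \in [set` A]) (f x)%:E)%E = (\sum_(x <- A) f x)%:E.
  by rewrite fsbig_finite//= set_fsetK sumEFin.
apply/eqP; rewrite eq_le; apply/andP; split.
- apply: ub_ereal_sup => _ [A [finA AD] <-].
  have [n An] : exists n, fset_set A `<=` F n.
    by apply: (exhausts_fset DF) => x; rewrite in_fset_set// => /set_mem/AD.
  rewrite -{1}(fset_setK finA) sumE lee_fin (le_trans (ler_sum_fsubset An f0))//.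
  have : limn (fun n => \sum_(x <- F n) f x) = s by apply: cvg_lim.
  by move=> <-; apply: (nondecreasing_cvgn_le u_nd); apply/cvg_ex; exists s.
  have cv : (fun n => ((\sum_(x <- F n) f x)%:E : \bar R)) @ \oo --> s%:E.
    by apply: cvg_EFin => //; exact: nearW.
  apply: (@cvge_to_le _ _ _ _ _ _ _ cv); apply: nearW => n.
  rewrite -sumE; apply: ereal_sup_ubound; exists [set` F n] => //; split => //.
  by move=> x /= /FD.
Qed.

End unordered_sums.

(** * Bounded convergence for signed and complex measures *)

Section bounded_measurable.
Context d {T : measurableType d} {R : realType}.
Implicit Types (f g : T -> R) (m : {finite_measure set T -> \bar R}).

(** Such functions are integrable against every finite measure, so integrability need not be tracked
    separately for each measure below. *)
Definition bmfun f : Prop :=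
  measurable_fun setT f /\ exists M, forall x, `|f x| <= M.

Lemma bmfun_cst (r : R) : bmfun (fun=> r).
Proof. by split; [exact: measurable_cst|exists `|r|]. Qed.

Lemma bmfunD f g : bmfun f -> bmfun g -> bmfun (fun x => f x + g x).
Proof.
move=> [mf [M fM]] [mg [N gN]]; split; first exact: measurable_funD.
by exists (M + N) => x; rewrite (le_trans (ler_normD _ _))// lerD.
Qed.

Lemma bmfunM f g : bmfun f -> bmfun g -> bmfun (fun x => f x * g x).
Proof.
move=> [mf [M fM]] [mg [N gN]]; split; first exact: measurable_funM.
by exists (M * N) => x; rewrite normrM ler_pM.
Qed.

Lemma bmfunZ (r : R) f : bmfun f -> bmfun (fun x => r * f x).
Proof. exact/bmfunM/bmfun_cst. Qed.

Lemma bmfunN f : bmfun f -> bmfun (fun x => - f x).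
Proof.
move=> [mf [M fM]]; split; first exact: measurable_funN.
by exists M => x; rewrite normrN.
Qed.

Lemma bmfunB f g : bmfun f -> bmfun g -> bmfun (fun x => f x - g x).
Proof. by move=> bf bg; apply: bmfunD => //; exact: bmfunN. Qed.

Lemma bmfun_indic (A : set T) : measurable A -> bmfun \1_A.
Proof.
move=> mA; split; first exact: measurable_indic.
by exists 1 => x; rewrite indicE; case: (x \in A); rewrite ?normr1 ?normr0.
Qed.

Lemma bmfun_cvg (f_ : nat -> T -> R) f (M : R) :
  (forall n, measurable_fun setT (f_ n)) -> (forall n x, `|f_ n x| <= M) ->
  (forall x, f_ ^~ x @ \oo --> f x) -> bmfun f.
Proof.
move=> mf fM fl; split; first by apply: (measurable_fun_cvg mf) => x _; exact: fl.
exists M => x; apply: (cvgr_to_le (cvg_norm (fl x))).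
by apply: nearW => n; exact: fM.
Qed.

Lemma bmfun_integrable m f : bmfun f -> m.-integrable setT (EFin \o f).
Proof.
move=> [mf [M fM]]; apply: measurable_bounded_integrable => //.
  by rewrite -ge0_fin_numE//; exact: fin_num_measure.
exists M; split; first exact: num_real.
by move=> x Mx y _ /=; rewrite (le_trans (fM y))// ltW.
Qed.

Lemma Rintegral_cvg m (f_ : nat -> T -> R) f (M : R) :
  (forall n, measurable_fun setT (f_ n)) -> (forall n x, `|f_ n x| <= M) ->
  (forall x, f_ ^~ x @ \oo --> f x) ->
  (fun n => Rintegral m setT (f_ n)) @ \oo --> Rintegral m setT f.
Proof.
move=> mf fM fl; have bf := bmfun_cvg mf fM fl.
have [_ _ cv] : [/\ m.-integrable setT (EFin \o f),
    [sequence (\int[m]_x `|(f_ n x)%:E - (f x)%:E|)%E]_n @ \oo --> 0%E &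
    [sequence (\int[m]_x (f_ n x)%:E)%E]_n @ \oo --> (\int[m]_x (f x)%:E)%E].
  apply: (@dominated_convergence _ _ _ m setT measurableT _ _ (EFin \o cst M)) => //.
  - by move=> n; exact/measurable_EFinP.
  - by apply/measurable_EFinP; exact: bf.1.
  - by apply: aeW => x _; apply: cvg_EFin; [exact: nearW|exact: fl].
  - exact/bmfun_integrable/bmfun_cst.
  - by apply: aeW => x n _; rewrite lee_fin; exact: fM.
apply: fine_cvg; rewrite /Rintegral fineK; first exact: cv.
exact: (integrable_fin_num measurableT (bmfun_integrable _ bf)).
Qed.

Lemma Rintegral_indic m (A : set T) : measurable A ->
  Rintegral m setT \1_A = fine (m A).
Proof. by move=> mA; rewrite /Rintegral integral_indic// setIT. Qed.

Lemma RintegralT_D m f g : bmfun f -> bmfun g ->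
  Rintegral m setT (fun x => f x + g x) = Rintegral m setT f + Rintegral m setT g.
Proof. by move=> bf bg; apply: RintegralD => //; exact: bmfun_integrable. Qed.

Lemma RintegralT_Z m (r : R) f : bmfun f ->
  Rintegral m setT (fun x => r * f x) = r * Rintegral m setT f.
Proof. by move=> bf; apply: RintegralZl => //; exact: bmfun_integrable. Qed.

End bounded_measurable.

Section charge_integral_theory.
Context d {T : measurableType d} {R : realType}.
Implicit Types (f g : T -> R) (nu : {charge set T -> \bar R}).

(** Hides the Hahn decomposition chosen inside [charge_integral]: later arguments only see a
    difference of two finite measures. *)
Lemma charge_decomposition nu : exists p n : {finite_measure set T -> \bar R},
  (forall g, charge_integral nu g = Rintegral p setT g - Rintegral n setT g) /\
  (forall A, measurable A -> fine (nu A) = fine (p A) - fine (n A)).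
Proof.
rewrite /charge_integral; case: cid => P exN; case: cid => N nuPN.
exists (jordan_pos nuPN), (jordan_neg nuPN); split => // A mA.
rewrite (jordan_decomp nuPN mA) /cadd /= cscaleN1 fineB//.
- exact: (@fin_num_measure _ _ _ (jordan_pos nuPN)).
- exact: (@fin_num_measure _ _ _ (jordan_neg nuPN)).
Qed.

Lemma charge_integral_cvg nu (f_ : nat -> T -> R) f (M : R) :
  (forall n, measurable_fun setT (f_ n)) -> (forall n x, `|f_ n x| <= M) ->
  (forall x, f_ ^~ x @ \oo --> f x) ->
  (fun n => charge_integral nu (f_ n)) @ \oo --> charge_integral nu f.
Proof.
move=> mf fM fl; have [p [n [E _]]] := charge_decomposition nu.
under eq_fun do rewrite E.
have cv m := Rintegral_cvg (m := m) mf fM fl.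
by rewrite E; exact: (cvgB (cv p) (cv n)).
Qed.

Lemma charge_integralD nu f g : bmfun f -> bmfun g ->
  charge_integral nu (fun x => f x + g x) =
  charge_integral nu f + charge_integral nu g.
Proof.
move=> bf bg; have [p [n [E _]]] := charge_decomposition nu.
by rewrite !E !RintegralT_D//; ring.
Qed.

Lemma charge_integralZ nu (r : R) f : bmfun f ->
  charge_integral nu (fun x => r * f x) = r * charge_integral nu f.
Proof.
move=> bf; have [p [n [E _]]] := charge_decomposition nu.
by rewrite !E !RintegralT_Z//; ring.
Qed.

Lemma charge_integral_indic nu (A : set T) : measurable A ->
  charge_integral nu \1_A = fine (nu A).
Proof.
move=> mA; have [p [n [E nuE]]] := charge_decomposition nu.
by rewrite E nuE// !Rintegral_indic.
Qed.

(** Any presentation of [nu] as a difference of finite measures computes the integral. If [p' - n']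
    and [p - n] agree, then [p' + n] and [p + n'] are the same measure, and their integrals of [f]
    coincide. *)
Lemma charge_integral_diff nu (p n : {finite_measure set T -> \bar R}) f :
  (forall A, measurable A -> fine (nu A) = fine (p A) - fine (n A)) ->
  bmfun f -> charge_integral nu f = Rintegral p setT f - Rintegral n setT f.
Proof.
move=> nuE bf; have [p' [n' [E nuE']]] := charge_decomposition nu.
have addE (m1 m2 : {finite_measure set T -> \bar R}) :
    Rintegral m1 setT f + Rintegral m2 setT f = Rintegral (measure_add m1 m2) setT f.
  rewrite /Rintegral integral_measure_add//; try exact: bmfun_integrable.
  have fin (m : {finite_measure set T -> \bar R}) : (\int[m]_x (f x)%:E)%E \is a fin_num.
    exact: (integrable_fin_num measurableT (bmfun_integrable m bf)).
  by rewrite (fineD (fin m1) (fin m2)).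
rewrite E; apply/eqP; rewrite subr_eq addrAC eq_sym subr_eq eq_sym; apply/eqP.
rewrite !addE; congr fine; apply: eq_measure_integral => A mA _.
have fin (m : {finite_measure set T -> \bar R}) : m A = (fine (m A))%:E.
  by rewrite fineK//; exact: fin_num_measure.
have addA (m1 m2 : {finite_measure set T -> \bar R}) :
    measure_add m1 m2 A = (m1 A + m2 A)%E by exact: measure_addE.
rewrite [LHS](addA p' n) [RHS](addA p n') (fin p) (fin p') (fin n) (fin n') -!EFinD; congr EFin.
by have := nuE _ mA; rewrite nuE'//; lra.
Qed.

End charge_integral_theory.

Section complex_integral_theory.
Context d {T : measurableType d} {R : realType}.
Implicit Types (f g : T -> C R) (mu : {charge set T -> \bar (C R)}).

Definition measurable_funC f : Prop :=
  measurable_fun setT (fun x => reC (f x)) /\ measurable_fun setT (fun x => imC (f x)).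

Definition bmfunC f : Prop :=
  bmfun (fun x => reC (f x)) /\ bmfun (fun x => imC (f x)).

Lemma bmfunCP f (M : R) : measurable_funC f -> (forall x, normR (f x) <= M) -> bmfunC f.
Proof.
move=> [mr mi] fM; split; split=> //; exists M => x.
- exact: le_trans (abs_reC_le _) (fM x).
- exact: le_trans (abs_imC_le _) (fM x).
Qed.

Lemma bmfunC_measurable f : bmfunC f -> measurable_funC f.
Proof. by move=> [[? _] [? _]]. Qed.

Lemma measurable_funC_cvg (f_ : nat -> T -> C R) f :
  (forall n, measurable_funC (f_ n)) -> (forall x, f_ ^~ x @ \oo --> f x) -> measurable_funC f.
Proof.
move=> mf fl; split.
- apply: (measurable_fun_cvg (fun n => (mf n).1)) => x _; exact: cvg_reC (fl x).
- apply: (measurable_fun_cvg (fun n => (mf n).2)) => x _; exact: cvg_imC (fl x).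
Qed.

Lemma bmfunCD f g : bmfunC f -> bmfunC g -> bmfunC (fun x => f x + g x).
Proof.
move=> [fr fi] [gr gi]; split.
- by under eq_fun do rewrite raddfD /=; exact: bmfunD.
- by under eq_fun do rewrite raddfD /=; exact: bmfunD.
Qed.

Lemma bmfunCZ (c : C R) f : bmfunC f -> bmfunC (fun x => c * f x).
Proof.
move=> [fr fi]; split.
- by under eq_fun do rewrite reCM; apply: bmfunB; exact: bmfunZ.
- by under eq_fun do rewrite imCM; apply: bmfunD; exact: bmfunZ.
Qed.

Lemma bmfunC0 : bmfunC (fun=> 0 : C R).
Proof. by split; exact: bmfun_cst. Qed.

Lemma bmfunC_sum I (r : seq I) (f : I -> T -> C R) : (forall i, bmfunC (f i)) ->
  bmfunC (fun x => \sum_(i <- r) f i x).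
Proof.
move=> bf; elim: r => [|i r IH].
  by under eq_fun do rewrite big_nil; exact: bmfunC0.
by under eq_fun do rewrite big_cons; exact: bmfunCD.
Qed.

Definition cindic (A : set T) (x : T) : C R := ofR (\1_A x).

Lemma cindicE (A : set T) (x : T) : cindic A x = (x \in A)%:R.
Proof. by rewrite /cindic indicE; case: (x \in A). Qed.

Lemma bmfunC_cindic (A : set T) : measurable A -> bmfunC (cindic A).
Proof. by move=> mA; split; [exact: bmfun_indic|exact: bmfun_cst]. Qed.

Lemma complex_integralD mu f g : bmfunC f -> bmfunC g ->
  complex_integral mu (fun x => f x + g x) =
  complex_integral mu f + complex_integral mu g.
Proof.
move=> [fr fi] [gr gi]; rewrite /complex_integral.
have -> : (fun x => reC (f x + g x)) = (fun x => reC (f x) + reC (g x)).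
  by apply/funext => x; rewrite raddfD.
have -> : (fun x => imC (f x + g x)) = (fun x => imC (f x) + imC (g x)).
  by apply/funext => x; rewrite raddfD.
by rewrite !charge_integralD//; apply: C_eqP => /=; ring.
Qed.

Lemma complex_integralZ mu (c : C R) f : bmfunC f ->
  complex_integral mu (fun x => c * f x) = c * complex_integral mu f.
Proof.
move=> [fr fi]; rewrite /complex_integral.
have -> : (fun x => reC (c * f x)) = (fun x => reC c * reC (f x) + (- imC c) * imC (f x)).
  by apply/funext => x; rewrite reCM mulNr.
have -> : (fun x => imC (c * f x)) = (fun x => reC c * imC (f x) + imC c * reC (f x)).
  by apply/funext => x; rewrite imCM.
rewrite !charge_integralD//; try exact: bmfunZ.
rewrite !charge_integralZ//; apply: C_eqP; rewrite ?reCM ?imCM /=; ring.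
Qed.

Lemma complex_integral0 mu : complex_integral mu (fun=> 0) = 0.
Proof.
have := complex_integralZ mu 0 bmfunC0.
by under eq_fun do rewrite mul0r; rewrite mul0r.
Qed.

Lemma complex_integral_sum mu I (r : seq I) (f : I -> T -> C R) :
  (forall i, bmfunC (f i)) ->
  complex_integral mu (fun x => \sum_(i <- r) f i x) =
  \sum_(i <- r) complex_integral mu (f i).
Proof.
move=> bf; elim: r => [|i r IH].
  by under eq_fun do rewrite big_nil; rewrite big_nil complex_integral0.
under eq_fun do rewrite big_cons.
by rewrite big_cons complex_integralD// ?IH//; exact: bmfunC_sum.
Qed.

Lemma complex_integral_indic mu (A : set T) : measurable A ->
  complex_integral mu (cindic A) = fine (mu A).
Proof.
move=> mA; rewrite /complex_integral.
have z (nu : {charge set T -> \bar R}) : charge_integral nu (fun=> 0) = 0.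
  have [p [n [-> _]]] := charge_decomposition nu.
  by rewrite /Rintegral !integral0 subrr.
have -> : (fun x => reC (cindic A x)) = \1_A by [].
have -> : (fun x => imC (cindic A x)) = fun=> 0 by [].
rewrite !z !charge_integral_indic// subr0 add0r.
by rewrite /re_charge /im_charge /charge_map /=; case: (fine _).
Qed.

(** Dominated convergence by a constant, applied to the four real charge integrals that make up a
    complex one. *)
Lemma complex_integral_cvg mu (f_ : nat -> T -> C R) f (M : R) :
  (forall n, measurable_funC (f_ n)) -> (forall n x, normR (f_ n x) <= M) ->
  (forall x, f_ ^~ x @ \oo --> f x) ->
  (fun n => complex_integral mu (f_ n)) @ \oo --> complex_integral mu f.
Proof.
move=> mf fM fl.
have cvr nu : (fun n => charge_integral nu (fun x => reC (f_ n x))) @ \oo -->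
    charge_integral nu (fun x => reC (f x)).
  apply: (@charge_integral_cvg _ _ _ nu (fun n x => reC (f_ n x)) _ M).
  - by move=> n; exact: (mf n).1.
  - by move=> n x; rewrite (le_trans (abs_reC_le _)).
  - by move=> x; exact: cvg_reC.
have cvi nu : (fun n => charge_integral nu (fun x => imC (f_ n x))) @ \oo -->
    charge_integral nu (fun x => imC (f x)).
  apply: (@charge_integral_cvg _ _ _ nu (fun n x => imC (f_ n x)) _ M).
  - by move=> n; exact: (mf n).2.
  - by move=> n x; rewrite (le_trans (abs_imC_le _)).
  - by move=> x; exact: cvg_imC.
by apply: cvg_reim => /=; [exact: cvgB|exact: cvgD].
Qed.

Lemma complex_integral_bounded mu : exists B : R, forall f, measurable_funC f ->
  (forall x, normR (f x) <= 1) -> normR (complex_integral mu f) <= B.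
Proof.
have bound (nu : {charge set T -> \bar R}) : exists B : R, forall g : T -> R,
    measurable_fun setT g -> (forall x, `|g x| <= 1) -> `|charge_integral nu g| <= B.
  have [p [n [E _]]] := charge_decomposition nu.
  exists (fine (p setT) + fine (n setT)) => g mg g1; rewrite E.
  have le (m : {finite_measure set T -> \bar R}) : `|Rintegral m setT g| <= fine (m setT).
    have bg : bmfun g by split => //; exists 1.
    have bg' : bmfun (fun x => `|g x|).
      by split; [exact: measurableT_comp|exists 1 => x; rewrite normr_id].
    apply: le_trans (le_normr_Rintegral measurableT (bmfun_integrable m bg)) _.
    rewrite -[leRHS]mul1r -(Rintegral_cst m measurableT 1).
    apply: le_Rintegral => //; first exact: bmfun_integrable.
    exact/bmfun_integrable/bmfun_cst.
  by rewrite (le_trans (ler_normB _ _))// lerD.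
have [B bB] := bound (re_charge mu); have [B' bB'] := bound (im_charge mu).
(* Each coordinate of the integral combines one integral against [re_charge mu] and one against
   [im_charge mu], hence is at most [B + B'] in absolute value. *)
exists ((B + B') + (B + B')) => f [mr mi] f1.
have r1 x : `|reC (f x)| <= 1 by exact: le_trans (abs_reC_le _) (f1 x).
have i1 x : `|imC (f x)| <= 1 by exact: le_trans (abs_imC_le _) (f1 x).
rewrite (le_trans (normR_le_reim _))// lerD//=.
- by rewrite (le_trans (ler_normB _ _))// lerD// ?bB ?bB'.
- by rewrite (le_trans (ler_normD _ _))// lerD// ?bB ?bB'.
Qed.

End complex_integral_theory.

(** * Countable supports and point masses *)

Lemma countable_support {R : realType} {T : choiceType} (f : T -> R) (M : R) :
  (forall x, 0 <= f x) -> (forall A : {fset T}, \sum_(x <- A) f x <= M) ->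
  countable [set x | f x != 0].
Proof.
move=> f0 fM.
have -> : [set x | f x != 0] = \bigcup_n [set x | n.+1%:R^-1 < f x].
  apply/seteqP; split=> [x /= fx|x [n _] /= nx]; last first.
    by rewrite gt_eqF// (lt_trans _ nx)// invr_gt0.
    have fx0 : 0 < f x by rewrite lt_neqAle eq_sym fx f0.
    have [n _ nx] := near_infty_natSinv_lt (PosNum fx0).
    by exists n => //=; exact: (nx n (leqnn n)).
apply: bigcup_countable => // n _; apply: finite_set_countable.
(* If the level set were infinite, more than [|M| * (n + 1)] of its points, each of weight above
   [1 / (n + 1)], would have total weight above [M]. *)
apply: contrapT => /infinite_set_fsetP /(_ (Num.truncn (`|M| * n.+1%:R)).+1)[A AS nA].
have := fM A; apply/negP; rewrite -ltNge.
apply: (@lt_le_trans _ _ (\sum_(x <- A) n.+1%:R^-1)).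
  rewrite big_const_seq count_predT iter_addr_0 -[ltRHS]mulr_natl.
  rewrite ltr_pdivlMr// (le_lt_trans (ler_wpM2r _ (ler_norm M)))//.
  apply: (@lt_le_trans _ _ (Num.truncn (`|M| * n.+1%:R)).+1%:R); last by rewrite ler_nat.
  by rewrite truncnS_gt.
rewrite big_seq [leRHS]big_seq; apply: ler_sum => x xA.
by apply: ltW; exact: (AS x).
Qed.

Section point_masses.
Context d {T : measurableType d} {R : realType}.
Hypothesis mset1 : forall x : T, measurable [set x].
Local Open Scope fset_scope.

Definition mass (mu : {charge set T -> \bar (C R)}) (x : T) : C R := fine (mu [set x]).

Lemma massE (mu : {charge set T -> \bar (C R)}) x : mu [set x] = (mass mu x)%:E.
Proof. by rewrite /mass fineK//; exact: fin_num_measure. Qed.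

Lemma atomsE (mu : {charge set T -> \bar (C R)}) x : atoms mu x <-> mass mu x != 0.
Proof. by rewrite /atoms /= massE eqe. Qed.

Lemma mass_eq0 (mu : {charge set T -> \bar (C R)}) x : ~ atoms mu x -> mass mu x = 0.
Proof. by rewrite atomsE => /negP/negPn/eqP. Qed.

Lemma sum_measure_set1_le (p : {finite_measure set T -> \bar R}) (A : {fset T}) :
  \sum_(x <- A) fine (p [set x]) <= fine (p setT).
Proof.
have fin B : measurable B -> p B = (fine (p B))%:E.
  by move=> mB; rewrite fineK//; exact: fin_num_measure.
rewrite -lee_fin -fin// -sumEFin.
under eq_bigr do rewrite -fin//.
rewrite -measure_fbigsetU//.
  by apply: le_measure; rewrite ?inE//; exact: bigsetU_measurable.
by move=> x y _ _ [z [/= -> ->]].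
Qed.

(** Each point mass is dominated by the masses that the four measures decomposing the real and
    imaginary parts give to the point. Over distinct points these add up to at most the total
    masses. *)
Lemma sum_charge_set1_le (mu : {charge set T -> \bar (C R)}) :
  exists M : R, forall A : {fset T}, \sum_(x <- A) normR (mass mu x) <= M.
Proof.
have [p [n [_ pn]]] := charge_decomposition (re_charge mu).
have [p' [n' [_ pn']]] := charge_decomposition (im_charge mu).
exists ((fine (p setT) + fine (n setT)) + (fine (p' setT) + fine (n' setT)))%R => A.
have le x : normR (mass mu x) <=
    ((fine (p [set x]) + fine (n [set x])) + (fine (p' [set x]) + fine (n' [set x])))%R.
  have ge0 (m : {finite_measure set T -> \bar R}) : `|fine (m [set x])| = fine (m [set x]).
    by rewrite ger0_norm// fine_ge0.
  apply: (le_trans (normR_le_reim _)); apply: lerD.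
  - rewrite -(ge0 p) -(ge0 n) (_ : reC _ = fine (re_charge mu [set x]))// pn//.
    exact: ler_normB.
  - rewrite -(ge0 p') -(ge0 n') (_ : imC _ = fine (im_charge mu [set x]))// pn'//.
    exact: ler_normB.
apply: (le_trans (ler_sum _ (fun x _ => le x))).
by rewrite !big_split /= !lerD// sum_measure_set1_le.
Qed.

Lemma countable_atoms (mu : {charge set T -> \bar (C R)}) : countable (atoms mu).
Proof.
have [M leM] := sum_charge_set1_le mu.
apply: sub_countable (countable_support (fun x => normR_ge0 (mass mu x)) leM).
apply: subset_card_le => x /atomsE mx /=; apply: contra mx => /eqP nx.
by rewrite -normr_eq0 -ofR_normR nx.
Qed.

Lemma sum_cindic (f : T -> C R) (A : {fset T}) (x : T) :
  \sum_(a <- A) f a * cindic [set a] x = if x \in A then f x else 0.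
Proof.
under eq_bigr do rewrite cindicE.
case: ifPn => xA.
  rewrite (big_fsetD1 x)//= mem_set// mulr1 big1_fset ?addr0// => i.
  rewrite !inE => /andP[ix _] _; rewrite memNset ?mulr0// => xi.
  by rewrite xi eqxx in ix.
rewrite big1_fset// => i iA _; rewrite memNset ?mulr0// => xi.
by rewrite xi iA in xA.
Qed.

(** At a given point the sequence is eventually constant: it equals [f x] as soon as [F n] contains
    [x], and it is always 0 if [x] lies outside [D]. *)
Lemma cvg_sum_cindic (D : set T) (F : nat -> {fset T}) (f : T -> C R) x :
  exhausts D F -> (forall x, ~ D x -> f x = 0) ->
  (fun n => \sum_(a <- F n) f a * cindic [set a] x) @ \oo --> f x.
Proof.
move=> [Fm _ Fc] fD; under eq_fun do rewrite sum_cindic.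
have [Dx|nDx] := pselect (D x); last first.
  by rewrite fD//; under eq_fun do rewrite if_same; exact: cvg_cst.
have [m xm] := Fc x Dx; apply: cvg_near_cst; exists m => // n /= mn.
by rewrite (fsubsetP (Fm _ _ mn)).
Qed.

(** Such a function is a pointwise limit of finite combinations of indicators of points, so a
    countable support alone gives measurability. *)
Lemma measurable_funC_countable (D : set T) (f : T -> C R) :
  countable D -> (forall x, ~ D x -> f x = 0) -> measurable_funC f.
Proof.
move=> /countable_exhausts[F DF] fD.
apply: (measurable_funC_cvg _ (fun x => cvg_sum_cindic (x := x) DF fD)) => n.
apply/bmfunC_measurable/bmfunC_sum => a; apply: bmfunCZ.
exact/bmfunC_cindic/mset1.
Qed.

(** The integral of a function with countable support only sees atoms. Its finite truncations
    integrate to finite sums of point masses, and bounded convergence passes to the limit. *)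
Lemma has_sum_complex_integral (mu : {charge set T -> \bar (C R)}) (D : set T)
    (f : T -> C R) (M : R) :
  countable D -> (forall x, ~ D x -> f x = 0) -> (forall x, normR (f x) <= M) ->
  has_sum (atoms mu) (fun a => f a * mass mu a) (complex_integral mu f).
Proof.
move=> cD fD fM.
(* The exhausted set must contain [D] for the truncations to converge to [f], and the atoms for the
   final index set. The added points that are not atoms contribute zero terms. *)
have cDa : countable (D `|` atoms mu)%classic.
  by rewrite -bigcup2E; apply: bigcup_countable => // -[|[|n]] _ //=; exact: countable_atoms.
have [F DF] := countable_exhausts cDa.
have M0 : 0 <= M by exact: le_trans (normR_ge0 _) (fM point).
have [B leB] := sum_charge_set1_le mu.
have fDa x : ~ (D `|` atoms mu)%classic x -> f x = 0.
  by move=> nx; apply: fD => Dx; apply: nx; left.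
have bf n : bmfunC (fun x => \sum_(a <- F n) f a * cindic [set a] x).
  by apply: bmfunC_sum => a; apply: bmfunCZ; exact/bmfunC_cindic/mset1.
have h : has_sum (D `|` atoms mu)%classic (fun a => f a * mass mu a) (complex_integral mu f).
  apply: (has_sum_exhausts (M := M * B) DF) => [A _|].
    apply: (@le_trans _ _ (\sum_(x <- A) M * normR (mass mu x))).
      by apply: ler_sum => x _; rewrite normRM ler_wpM2r// normR_ge0.
    by rewrite -mulr_sumr ler_wpM2l.
  have -> : (fun n => \sum_(x <- F n) f x * mass mu x) =
      (fun n => complex_integral mu (fun x => \sum_(a <- F n) f a * cindic [set a] x)).
    apply/funext => n; rewrite complex_integral_sum; last first.
      by move=> a; apply: bmfunCZ; exact/bmfunC_cindic/mset1.
    apply: eq_bigr => a _; rewrite complex_integralZ; last exact/bmfunC_cindic/mset1.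
    by rewrite complex_integral_indic.
  apply: (complex_integral_cvg (M := M)).
  - by move=> n; exact: bmfunC_measurable.
  - by move=> n x; rewrite sum_cindic; case: ifP => // _; rewrite normR0.
  - by move=> x; exact: (cvg_sum_cindic (x := x) DF fDa).
rewrite /has_sum (_ : (_ \_ (atoms mu))%R =
  ((fun a => f a * mass mu a) \_ (D `|` atoms mu)%classic)%R)//.
apply/funext => x; rewrite /patch.
case: ifPn => [/set_mem ax|/negP ax]; first by rewrite mem_set//; right.
by case: ifP => // _; rewrite mass_eq0 ?mulr0// => /mem_set.
Qed.

End point_masses.

(** * Averages of characters of the circle *)

Section circle_theory.
Context {R : realType}.
Local Notation T := (circle R).
Implicit Types (z w : T) (f : T -> C R).

Lemma circle_valM z w : circle_val (z * w)%g = circle_val z * circle_val w.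
Proof. by []. Qed.

Lemma circle_valV z : circle_val (z^-1)%g = (circle_val z)^*.
Proof. by []. Qed.

Lemma circle_mulC z w : (z * w = w * z)%g.
Proof. by apply: circle_valP; rewrite !circle_valM mulrC. Qed.

Lemma normR_circleX z n : normR (circle_val z ^+ n) = 1.
Proof.
by apply: (can_inj (@reC_ofR R)); rewrite ofR_normR normrX circle_norm expr1n.
Qed.

Lemma circle_val_continuous : continuous (@circle_val R).
Proof. exact: initial_continuous. Qed.

Lemma circle_open_measurable (A : set T) : open A -> measurable A.
Proof. exact: sub_sigma_algebra. Qed.

Lemma circle_measurable_set1 z : measurable [set z].
Proof.
rewrite -[X in measurable X]setCK; apply: measurableC; apply: circle_open_measurable.
have -> : (~` [set z] = @circle_val R @^-1` (~` [set circle_val z]))%classic.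
  apply/seteqP; split=> w /= wz; first by move/circle_valP.
  by move=> wz'; apply: wz; rewrite wz'.
apply: open_comp; first by move=> w _; exact: circle_val_continuous.
rewrite openC; apply: accessible_closed_set1.
exact/hausdorff_accessible/norm_hausdorff.
Qed.

Lemma bmfunC_circle_set1 z : bmfunC (cindic [set z] : T -> C R).
Proof. by apply: bmfunC_cindic; exact: circle_measurable_set1. Qed.

Lemma circle_continuous_measurable (g : T -> R) : continuous g -> measurable_fun setT g.
Proof.
move=> /continuousP cg; apply: (measurability _ (RGenOpens.measurableE R)).
move=> _ [_ [a [b ->] <-]]; rewrite setTI; apply: circle_open_measurable.
exact/cg/interval_open.
Qed.

Lemma measurable_funC_continuous f : continuous f -> measurable_funC f.
Proof.
move=> cf; split; apply: circle_continuous_measurable => z.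
- exact: cvg_reC (cf z).
- exact: cvg_imC (cf z).
Qed.

Lemma circle_valX_continuous n : continuous (fun z : T => circle_val z ^+ n).
Proof.
elim: n => [|n IH].
  rewrite (_ : (fun _ => _) = fun=> 1); first exact: cst_continuous.
  by apply/funext => z; rewrite expr0.
rewrite (_ : (fun _ => _) = fun z : T => circle_val z * circle_val z ^+ n); last first.
  by apply/funext => z; rewrite exprS.
move=> z; have cz : (@circle_val R) @ z --> circle_val z by exact: circle_val_continuous.
exact: cvgM cz (IH z).
Qed.

Lemma bmfunC_circleX (z : T) n : bmfunC (fun w : T => circle_val (z * w)%g ^+ n).
Proof.
apply: (@bmfunCP _ _ _ _ 1); last by move=> w; rewrite normR_circleX.
by under eq_fun do rewrite circle_valM exprMn; apply/bmfunC_measurable/bmfunCZ;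
  apply: (@bmfunCP _ _ _ _ 1);
  [exact/measurable_funC_continuous/circle_valX_continuous|move=> w; rewrite normR_circleX].
Qed.

Lemma normR_average_le (u : nat -> C R) (M : R) N : 0 <= M ->
  (forall n, normR (u n) <= M) -> normR (average u N) <= M.
Proof.
move=> M0 uM; rewrite /average normRM.
have -> : normR (N%:R^-1 : C R) = N%:R^-1.
  apply: (can_inj (@reC_ofR R)); rewrite ofR_normR ger0_norm ?invr_ge0//.
  by rewrite /ofR fmorphV rmorph_nat.
apply: (@le_trans _ _ (N%:R^-1 * (N%:R * M))).
  rewrite ler_wpM2l ?invr_ge0// (le_trans (normR_sum _ _ _))//.
  rewrite (le_trans (ler_sum _ (fun n _ => uM n)))//.
  by rewrite sumr_const_nat subn1 /= mulr_natl.
(* The empty average is 0, because the inverse of 0 is 0; here [0 <= M] is used. *)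
have [->|N0] := eqVneq N 0%N; first by rewrite invr0 mul0r.
by rewrite mulKf// pnatr_eq0.
Qed.

Lemma average_conj (u : nat -> C R) N : average (fun n => (u n)^*) N = (average u N)^*.
Proof. by rewrite /average rmorphM rmorph_sum /= fmorphV /= conjC_nat. Qed.

Lemma bmfunC_average (f : nat -> T -> C R) N : (forall n, bmfunC (f n)) ->
  bmfunC (fun x => average (fun n => f n x) N).
Proof. by move=> bf; rewrite /average; apply: bmfunCZ; exact: bmfunC_sum. Qed.

Lemma complex_integral_average (mu : {charge set T -> \bar (C R)})
    (f : nat -> T -> C R) N : (forall n, bmfunC (f n)) ->
  complex_integral mu (fun x => average (fun n => f n x) N) =
  average (fun n => complex_integral mu (f n)) N.
Proof.
move=> bf; rewrite /average complex_integralZ; last exact: bmfunC_sum.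
by rewrite complex_integral_sum.
Qed.

End circle_theory.

(** * Limits of Fourier averages along a good sequence *)

Section good_sequence.
Context {R : realType} (k : nat -> nat) (kgood : good R k).
Local Notation T := (circle R).
Local Notation c := (@limit_function R k).
Implicit Types (z w : T).

Lemma limit_function_cvg z : average (fun n => circle_val z ^+ k n) @ \oo --> c z.
Proof. exact: (kgood.2 z). Qed.

Lemma normR_limit_function z : normR (c z) <= 1.
Proof.
have cv : (fun N => normR (average (fun n => circle_val z ^+ k n) N)) @ \oo --> normR (c z).
  exact/cvg_normR/limit_function_cvg.
apply: (cvgr_to_le cv); apply: nearW => N.
by apply: normR_average_le => // n; rewrite normR_circleX.
Qed.

Lemma limit_functionV z : c (z^-1)%g = (c z)^*.
Proof.
apply: cvg_lim => //.
have -> : average (fun n => circle_val (z^-1)%g ^+ k n) =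
    (fun N => (average (fun n => circle_val z ^+ k n) N)^*).
  apply/funext => N; rewrite -average_conj; congr average.
  by apply/funext => n; rewrite circle_valV rmorphXn.
exact/cvg_conj/limit_function_cvg.
Qed.

Section measure.
Variable mu : {charge set T -> \bar (C R)}.

(** The function written G(z) in the outline above. *)
Definition limit_kernel (z : T) : C R := (complex_integral mu (fun w => c (z^-1 * w)%g))^*.

(** First bounded convergence, with [z] fixed: z^k times the conjugate of the k-th Fourier
    coefficient is the conjugate of the integral of (z^-1 w)^k in [w], and averages of these powers
    are bounded by 1. *)
Lemma average_circleX_cvg (z : T) :
  average (fun n => circle_val z ^+ k n * (fourier mu (k n))^*) @ \oo --> limit_kernel z.
Proof.
have -> : average (fun n => circle_val z ^+ k n * (fourier mu (k n))^*) =
    (fun N => (complex_integral mu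
      (fun w => average (fun n => circle_val (z^-1 * w)%g ^+ k n) N))^*).
  apply/funext => N; rewrite complex_integral_average; last first.
    by move=> n; exact: bmfunC_circleX.
  rewrite -average_conj; congr average; apply/funext => n.
  have -> : (fun w => circle_val (z^-1 * w)%g ^+ k n) =
      (fun w => (circle_val z ^+ k n)^* * circle_val w ^+ k n).
    by apply/funext => w; rewrite circle_valM circle_valV exprMn rmorphXn.
  rewrite complex_integralZ ?rmorphM /= ?conjCK//.
  have := @bmfunC_circleX R 1%g (k n).
  by under eq_fun do rewrite mul1g.
apply/cvg_conj/(complex_integral_cvg (M := 1)).
- by move=> N; apply/bmfunC_measurable/bmfunC_average => n; exact: bmfunC_circleX.
- by move=> N w; apply: normR_average_le => // n; rewrite normR_circleX.
- by move=> w; exact: limit_function_cvg.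
Qed.

(** Second bounded convergence: one factor of the squared modulus is written back as an integral of
    z^k in [z]. The bound [B] on all Fourier coefficients dominates the averages. *)
Lemma fourier_average_cvg :
  fourier_average mu k @ \oo --> complex_integral mu limit_kernel.
Proof.
have [B leB] := complex_integral_bounded mu.
have b1 n : bmfunC (fun w : T => circle_val w ^+ n).
  have := @bmfunC_circleX R 1%g n.
  by under eq_fun do rewrite mul1g.
have fB n : normR (fourier mu n) <= B.
  by apply: leB; [exact: bmfunC_measurable|move=> w; rewrite normR_circleX].
have B0 : 0 <= B by exact: le_trans (normR_ge0 _) (fB 0%N).
have E N : fourier_average mu k N = complex_integral mu
    (fun z => average (fun n => (fourier mu (k n))^* * circle_val z ^+ k n) N).
  rewrite complex_integral_average; last by move=> n; exact: bmfunCZ.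
  congr average; apply/funext => n.
  by rewrite complex_integralZ// normCK mulrC.
rewrite (funext E).
apply: (complex_integral_cvg (M := B)).
- by move=> N; apply/bmfunC_measurable/bmfunC_average => n; exact: bmfunCZ.
- move=> N w; apply: normR_average_le => // n.
  by rewrite normRM normR_circleX mulr1 normR_conj.
- move=> z; have := @average_circleX_cvg z.
  have -> // : average (fun n => circle_val z ^+ k n * (fourier mu (k n))^*) =
    average (fun n => (fourier mu (k n))^* * circle_val z ^+ k n).
  by congr average; apply/funext => n; rewrite mulrC.
Qed.

Hypothesis kcount : countable (spectrum R k).

(** The coefficient of [c l] in the expansion of [limit_kernel] at [z]; its integral is the inner
    sum over atoms. *)
Let translate (l z : T) : C R := (mass mu (z * l^-1)%g)^*.

Lemma countable_translate_support l : countable [set z | translate l z != 0].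
Proof.
apply: (@sub_countable _ _ _ ((fun a => (a * l)%g) @` atoms mu)); last first.
  by apply: (sub_countable (card_image_le _ _)); exact: (countable_atoms circle_measurable_set1).
apply: subset_card_le => z /= nz; exists (z * l^-1)%g; last by rewrite mulgVK.
apply/(atomsE circle_measurable_set1); apply: contra nz => /eqP m0.
by rewrite /translate m0 conjC0.
Qed.

Lemma translate_measurable l : measurable_funC (translate l).
Proof.
apply: (measurable_funC_countable circle_measurable_set1 (countable_translate_support l)).
by move=> z /negP/negPn/eqP.
Qed.

(** For fixed [z] the map from [l] to z l^-1 is injective, so this is a sum of masses of distinct
    points. The bound is uniform in [z]. *)
Lemma sum_translate_le : exists M : R, forall (A : {fset T}) z,
  \sum_(l <- A) normR (translate l z) <= M.
Proof.
have [M leM] := sum_charge_set1_le circle_measurable_set1 mu.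
exists M => A z; apply: le_trans (leM [fset (z * l^-1)%g | l in A]%fset).
rewrite big_imfset /=; last first.
  move=> l l' _ _ /(mulgI z) /(congr1 (fun x : T => x^-1)%g).
  by rewrite !invgK.
by apply: ler_sum => l _; rewrite /translate normR_conj.
Qed.

Lemma translate_normR_le : exists M : R, forall l z, normR (translate l z) <= M.
Proof.
have [M leM] := sum_translate_le; exists M => l z.
by have := leM [fset l]%fset z; rewrite big_seq_fset1.
Qed.

Lemma bmfunC_translate l : bmfunC (translate l).
Proof.
have [M leM] := translate_normR_le.
exact: (bmfunCP (translate_measurable l) (leM l)).
Qed.

Lemma has_sum_atom_term l :
  has_sum (atoms mu) (atom_term mu l) (complex_integral mu (translate l)).
Proof.
have [M leM] := translate_normR_le.
apply: (has_sum_complex_integral circle_measurable_set1 (countable_translate_support l) _ (leM l)).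
by move=> z /negP/negPn/eqP.
Qed.

(** As [c] vanishes off the spectrum, c(z^-1 w) is the sum over [l] of its values times indicators
    of the points w = z l^-1. Integrating in [w] turns each indicator into a point mass. *)
Lemma limit_kernel_series F (z : T) : exhausts (spectrum R k) F ->
  (fun n => \sum_(l <- F n) c l * translate l z) @ \oo --> limit_kernel z.
Proof.
move=> LF; rewrite /limit_kernel /translate.
pose f n (w : T) : C R := \sum_(l <- F n) (c l)^* * cindic [set (z * l^-1)%g] w.
have E n : \sum_(l <- F n) c l * (mass mu (z * l^-1)%g)^* = (complex_integral mu (f n))^*.
  rewrite complex_integral_sum; last first.
    by move=> l; apply: bmfunCZ; exact: bmfunC_circle_set1.
  rewrite rmorph_sum; apply: eq_bigr => l _ /=.
  rewrite complex_integralZ; last exact: bmfunC_circle_set1.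
  by rewrite complex_integral_indic ?rmorphM /= ?conjCK//; exact: circle_measurable_set1.
rewrite (funext E); apply: cvg_conj.
(* Seen from [l], the condition w = z l^-1 reads l = z w^-1. The sum in [l] thus has at most one
   nonzero term, which bounds it by 1 and gives its limit. *)
have fE n w : f n w = \sum_(l <- F n) (c l)^* * cindic [set l] (z * w^-1)%g.
  apply: eq_bigr => l _; congr (_ * _); rewrite !cindicE; congr ((_ : bool)%:R).
  apply/idP/idP => /set_mem /= e; apply/mem_set => /=.
    by rewrite e invgM invgK circle_mulC mulgVK.
  by rewrite -e invgM invgK circle_mulC mulgVK.
apply: (complex_integral_cvg (M := 1)).
- move=> n; apply/bmfunC_measurable/bmfunC_sum => l; apply: bmfunCZ.
  exact: bmfunC_circle_set1.
- move=> n w; rewrite fE sum_cindic; case: ifP => _; last by rewrite normR0.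
  by rewrite normR_conj normR_limit_function.
- move=> w; rewrite (funext (fun n => fE n w)).
  have -> : c (z^-1 * w)%g = (c (z * w^-1)%g)^*.
    by rewrite -limit_functionV invgM invgK circle_mulC.
  apply: (cvg_sum_cindic (f := fun l => (c l)^*) LF) => l /negP/negPn/eqP.
  by rewrite /limit_function => ->; rewrite conjC0.
Qed.

Lemma limit_kernel_measurable : measurable_funC limit_kernel.
Proof.
have [F LF] := countable_exhausts kcount.
apply: (measurable_funC_cvg _ (fun z => @limit_kernel_series F z LF)) => n.
by apply/bmfunC_measurable/bmfunC_sum => l; exact/bmfunCZ/bmfunC_translate.
Qed.

(** The series for [limit_kernel] is integrated term by term, its partial sums being bounded
    uniformly in [z]. *)
Lemma has_sum_spectrum : has_sum (spectrum R k)
  (fun l => c l * complex_integral mu (translate l)) (complex_integral mu limit_kernel).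
Proof.
have [F LF] := countable_exhausts kcount.
have [M leM] := sum_translate_le.
have [B leB] := sum_charge_set1_le circle_measurable_set1 mu.
have cle l (x : C R) : normR (c l * x) <= normR x.
  by rewrite normRM ler_piMl ?normR_ge0 ?normR_limit_function.
have M0 : 0 <= M by have := leM fset0 1%g; rewrite big_seq_fset0.
(* In the double family indexed by [l] and an atom [a], summing over [l] first gives at most [M]
   times the mass at [a]; the masses then sum to at most [B]. *)
apply: (has_sum_exhausts (M := M * B) LF).
- move=> A _; apply: (@le_trans _ _ (\sum_(l <- A) normR (complex_integral mu (translate l)))).
    by apply: ler_sum => l _; exact: cle.
  apply: (has_sum_normR_le (has_sum_atom_term)) => A'.
  rewrite exchange_big /=; apply: (@le_trans _ _ (\sum_(a <- A') M * normR (mass mu a))).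
    apply: ler_sum => a _; under eq_bigr do rewrite /atom_term normRM.
    by rewrite -mulr_suml ler_wpM2r ?normR_ge0//; exact: leM.
  by rewrite -mulr_sumr ler_wpM2l.
- have E n : \sum_(l <- F n) c l * complex_integral mu (translate l) =
      complex_integral mu (fun z => \sum_(l <- F n) c l * translate l z).
    rewrite complex_integral_sum; last by move=> l; exact/bmfunCZ/bmfunC_translate.
    by apply: eq_bigr => l _; rewrite complex_integralZ//; exact: bmfunC_translate.
  rewrite (funext E); apply: (complex_integral_cvg (M := M)).
  + move=> n; apply/bmfunC_measurable/bmfunC_sum => l; exact/bmfunCZ/bmfunC_translate.
  + move=> n z; rewrite (le_trans (normR_sum _ _ _))// (le_trans _ (leM (F n) z))//.
    by apply: ler_sum => l _; exact: cle.
  + by move=> z; exact: limit_kernel_series.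
Qed.

Lemma csum_atom_term l :
  csummable (atoms mu) (atom_term mu l) /\
  csum (atoms mu) (atom_term mu l) = complex_integral mu (translate l).
Proof.
have h := @has_sum_atom_term l.
by split; [apply/cvg_ex; eexists; exact: h|exact: has_sum_lim].
Qed.

(** [csum] is a [lim], which has some value even without convergence. The two summability clauses
    make the formula meaningful. *)
Lemma fourier_average_csum :
  [/\ forall l, spectrum R k l -> csummable (atoms mu) (atom_term mu l),
      csummable (spectrum R k)
        (fun l => c l * csum (atoms mu) (atom_term mu l)) &
      fourier_average mu k @ \oo -->
        csum (spectrum R k) (fun l => c l * csum (atoms mu) (atom_term mu l))].
Proof.
rewrite (_ : (fun l => _) = fun l => c l * complex_integral mu (translate l)); last first.
  by apply/funext => l; rewrite (csum_atom_term l).2.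
have h := has_sum_spectrum; split.
- by move=> l _; exact: (csum_atom_term l).1.
- by apply/cvg_ex; eexists; exact: h.
- by rewrite /csum (has_sum_lim h); exact: fourier_average_cvg.
Qed.

(** Without atoms every term of the series for [limit_kernel] is 0, so the kernel vanishes
    identically. *)
Lemma fourier_average_continuous :
  continuous_charge mu -> fourier_average mu k @ \oo --> (0 : C R).
Proof.
move=> mu0; have -> : 0 = complex_integral mu limit_kernel; last exact: fourier_average_cvg.
have tr0 : limit_kernel = fun=> 0.
  have [F LF] := countable_exhausts kcount.
  apply/funext => z; apply: (cvg_unique _ (@limit_kernel_series F z LF)) => //.
  rewrite (_ : (fun _ => _) = fun=> 0); first exact: cvg_cst.
  apply/funext => n; apply: big1 => l _; rewrite /translate mass_eq0 ?conjC0 ?mulr0//.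
    exact: circle_measurable_set1.
  by rewrite mu0.
by rewrite tr0 complex_integral0.
Qed.

End measure.
End good_sequence.

(** * Probability measures *)

Section probability_integral.
Context d {T : measurableType d} {R : realType} (mu : probability T R).
Implicit Types (f : T -> C R) (h : T -> R).
Local Notation pmass := (fun a => fine (mu [set a])).

Lemma complex_integral_probability f : bmfunC f ->
  complex_integral (complex_charge mu) f =
  mkC (Rintegral mu setT (fun x => reC (f x))) (Rintegral mu setT (fun x => imC (f x))).
Proof.
move=> [fr fi]; rewrite /complex_integral.
have Er h : bmfun h -> charge_integral (re_charge (complex_charge mu)) h = Rintegral mu setT h.
  move=> bh; rewrite (@charge_integral_diff _ _ _ _ mu (@mzero d T R))//.
    by rewrite /Rintegral integral_measure_zero subr0.
  by move=> A _; rewrite /mzero subr0.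
have Ei h : bmfun h -> charge_integral (im_charge (complex_charge mu)) h = 0.
  (* The imaginary part is the zero charge, presented here as [mu] minus itself. *)
  move=> bh; rewrite (@charge_integral_diff _ _ _ _ mu mu)// ?subrr//.
  by move=> A _; rewrite subrr.
by rewrite !Er// !Ei// subr0 addr0.
Qed.

Hypothesis mset1 : forall x : T, measurable [set x].

Lemma atoms_complex_charge : atoms (complex_charge mu) = atoms mu.
Proof.
apply/seteqP; split => a /=; apply: contra => /eqP.
  by move=> ma0; rewrite /complex_charge /charge_map /= ma0 raddf0.
move=> cma0; have e : fine (mu [set a]) = 0.
  have : ofR (fine (mu [set a])) = 0 by exact: (congr1 fine cma0).
  by move=> /(congr1 (@reC R)); rewrite reC_ofR raddf0.
by rewrite -[mu _]fineK ?e//; exact: fin_num_measure.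
Qed.

Lemma probability_mass_gt0 a : atoms mu a -> 0 < pmass a.
Proof.
move=> ma; rewrite lt_neqAle fine_ge0// andbT eq_sym.
apply: contra ma => /eqP e.
by rewrite -[mu _]fineK ?e//; exact: fin_num_measure.
Qed.

(** If the integral is 0, comparing [h] with [h a] times the indicator of an atom [a] forces
    [h a = 0]. Conversely, the countable support reduces the integral to a sum over atoms. *)
Lemma Rintegral_eq0P (D : set T) h : countable D -> bmfun h ->
  (forall x, 0 <= h x) -> (forall x, ~ D x -> h x = 0) ->
  Rintegral mu setT h = 0 <-> (forall a, atoms mu a -> h a = 0).
Proof.
move=> cD bh h0 hD; split=> [I0 a /probability_mass_gt0 ma|hat].
  have : h a * pmass a <= 0.
    rewrite -I0 -(Rintegral_indic mu (mset1 a)) -RintegralT_Z//; last exact: bmfun_indic.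
    apply: le_Rintegral => //; try apply: bmfun_integrable => //.
      exact/bmfunZ/bmfun_indic.
    move=> x _; rewrite indicE; have [/set_mem ->|_] := boolP (x \in [set a]).
      by rewrite mulr1.
    by rewrite mulr0.
  by rewrite pmulr_lle0// => ha; apply/eqP; rewrite eq_le ha h0.
have [_ [M hM]] := bh.
have hs : has_sum (atoms (complex_charge mu))
    (fun a => ofR (h a) * mass (complex_charge mu) a)
    (complex_integral (complex_charge mu) (fun x => ofR (h x))).
  apply: (has_sum_complex_integral mset1 cD (M := M)) => [x /hD ->//|x].
  by rewrite normR_ofR.
have : complex_integral (complex_charge mu) (fun x => ofR (h x)) = 0.
  rewrite -(has_sum_lim hs); apply: has_sum_lim; apply: has_sum0 => a.
  by rewrite atoms_complex_charge => /hat ->; rewrite mul0r.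
rewrite complex_integral_probability; first by move/(congr1 (@reC R)).
by split => //; exact: bmfun_cst.
Qed.

Lemma probability_countable0 (D : set T) : countable D ->
  (forall x, D x -> ~ atoms mu x) -> mu D = 0%E.
Proof.
move=> cD Dat; have mD : measurable D by exact: countable_measurable.
have I0 : Rintegral mu setT \1_D = 0.
  apply/(Rintegral_eq0P cD) => //; first exact: bmfun_indic.
  - by move=> x Dx; rewrite indicE memNset.
  - by move=> a aa; rewrite indicE memNset// => /Dat.
rewrite -[mu D]fineK; last exact: fin_num_measure.
by rewrite -(Rintegral_indic mu mD) I0.
Qed.

End probability_integral.

(** * Generated subgroups, their cosets and independent atoms *)

Section generated_subgroups.
Context {R : realType}.
Local Notation T := (circle R).
Implicit Types (L H : set T).
Local Open Scope group_scope.

Lemma generated_subgroup L : is_subgroup (generated L).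
Proof.
split=> [H [[]//]|x y Gx Gy H HL|x Gx H HL].
- by have [[_ HM _] _] := HL; apply: HM; [exact: Gx|exact: Gy].
- by have [[_ _ HV] _] := HL; apply: HV; exact: Gx.
Qed.

(** Every element is the value of a finite word in generators and their inverses. Letters are pairs
    of a code in [nat] and a boolean marking inversion, so there are countably many words. *)
Lemma countable_generated L : countable L -> countable (generated L).
Proof.
move=> /countable_injP[g ginj].
pose f n : T := xget 1 [set x | L x /\ g x = n].
have fg x : L x -> f (g x) = x.
  move=> Lx; rewrite /f; case: xgetP => [y _ [Ly gy]|/(_ x)]; last by case.
  by apply: ginj => //; exact: mem_set.
pose ev (s : seq (nat * bool)) : T :=
  foldr (fun p acc => (if p.2 then (f p.1)^-1 else f p.1) * acc) 1 s.
have evM s t : ev (s ++ t) = ev s * ev t.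
  by elim: s => [|p s IH] /=; rewrite ?mul1g// IH mulgA.
(* The word is not reversed: commutativity of the circle lets the marks be flipped in place. *)
have evV s : ev [seq (p.1, ~~ p.2) | p <- s] = (ev s)^-1.
  elim: s => [|p s IH] /=; first by rewrite invg1.
  by rewrite IH invgM circle_mulC; case: p.2; rewrite /= ?invgK.
apply: (@sub_countable _ _ _ (range ev)); last first.
  exact: (sub_countable (card_image_le _ _) (countableP _)).
apply: subset_card_le; apply: smallest_sub.
  split; first by exists [::].
  - by move=> _ _ [s _ <-] [t _ <-]; exists (s ++ t); rewrite ?evM.
  - by move=> _ [s _ <-]; exists [seq (p.1, ~~ p.2) | p <- s]; rewrite ?evV.
by move=> x Lx; exists [:: (g x, false)] => //=; rewrite mulg1 fg.
Qed.

Lemma cosetE H (a b : T) : coset a H b <-> H (a^-1 * b).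
Proof.
split=> [[h Hh <-]|Hab]; first by rewrite mulKg.
by exists (a^-1 * b); rewrite ?mulVKg.
Qed.

Lemma countable_coset H a : countable H -> countable (coset a H).
Proof. by move=> cH; exact: (sub_countable (card_image_le _ _) cH). Qed.

Lemma coset_refl L a : coset a (generated L) a.
Proof. by have [G1 _ _] := generated_subgroup L; apply/cosetE; rewrite mulVg. Qed.

Lemma dependentP L a b : dependent L a b <-> coset a (generated L) b.
Proof.
have [G1 GM GV] := generated_subgroup L.
split=> [->|/cosetE Gab]; first exact: coset_refl.
apply/seteqP; split=> x /cosetE Gx; apply/cosetE.
- have -> : b^-1 * x = (a^-1 * b)^-1 * (a^-1 * x) by rewrite invgM invgK mulgA mulgK.
  by apply: GM => //; exact: GV.
- have -> : a^-1 * x = (a^-1 * b) * (b^-1 * x) by rewrite mulgA mulgK.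
  exact: GM.
Qed.

(** An atom dependent on no member of [U] could be adjoined to [U], against maximality. *)
Lemma max_independent_atoms_dependent L (mu : probability T R) (U : set T) a :
  max_independent_atoms L mu U -> atoms mu a -> exists2 u, U u & dependent L u a.
Proof.
move=> [[Uat Uind] Umax] aa; apply: contrapT => nU.
have Ua : U a -> False by move=> Ua; apply: nU; exists a.
apply: Ua; have <- : (U `|` [set a])%classic = U; last by right.
apply: Umax; last by move=> x; left.
split=> [x [/Uat//|->//]|x y [Ux|->] [Uy|->] xy].
- exact: Uind.
- by move=> d; apply: nU; exists x.
- by move=> d; apply: nU; exists y => //; rewrite /dependent.
- by [].
Qed.

End generated_subgroups.

(** * The inequality for probability measures and its equality case *)

Section probability_measures.
Context {R : realType} (k : nat -> nat) (kgood : good R k).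
Hypothesis kcount : countable (spectrum R k).
Variable mu : probability (circle R) R.
Local Notation T := (circle R).
Local Notation c := (@limit_function R k).
(** This is the group called H in the outline above; the function called G there is
    [limit_kernel]. *)
Local Notation G := (generated (spectrum R k)).
Local Notation mset1 := (@circle_measurable_set1 R).
Implicit Types (z w : T).

Let cmu : {charge set T -> \bar (C R)} := complex_charge mu.

(* Nonnegative, because [c] vanishes off [G]; its double integral against [mu]
   is the gap between the two sides of the inequality. *)
Let defect_kernel (z w : T) : R := \1_(coset z G) w - reC (c (z^-1 * w)%g).

Let defect (z : T) : R := Rintegral mu setT (defect_kernel z).

Let coset_mass (z : T) : R := fine (mu (coset z G)).

Let cosetC z : countable (coset z G).
Proof. exact/countable_coset/countable_generated. Qed.

Let cosetM z : measurable (coset z G).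
Proof. by apply: countable_measurable (cosetC z); exact: mset1. Qed.

Let limit_off_coset z w : ~ coset z G w -> c (z^-1 * w)%g = 0.
Proof.
move=> zw; apply/eqP/negPn/negP => cn0; apply: zw; apply/cosetE.
exact: sub_gen_smallest.
Qed.

Let bmfunC_limit z : bmfunC (fun w => c (z^-1 * w)%g).
Proof.
apply: (bmfunCP _ (fun w => normR_limit_function kgood (z^-1 * w)%g)).
apply: (measurable_funC_countable mset1 (cosetC z)) => w; exact: limit_off_coset.
Qed.

Let defect_kernel_bmfun z : bmfun (defect_kernel z).
Proof. by apply: bmfunB; [exact: bmfun_indic|exact: (bmfunC_limit z).1]. Qed.

Let reC_limit_le1 z : reC (c z) <= 1.
Proof.
by apply: le_trans (normR_limit_function kgood z); apply: le_trans (abs_reC_le _); exact: ler_norm.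
Qed.

Let defect_kernel_ge0 z w : 0 <= defect_kernel z w.
Proof.
rewrite /defect_kernel indicE; have [zw|zw] := pselect (coset z G w).
  by rewrite mem_set// subr_ge0.
by rewrite memNset// limit_off_coset// subrr.
Qed.

Let defect_kernel_off_coset z w : ~ coset z G w -> defect_kernel z w = 0.
Proof. by move=> zw; rewrite /defect_kernel indicE memNset// limit_off_coset// subrr. Qed.

Let defect_ge0 z : 0 <= defect z.
Proof. by apply: Rintegral_ge0 => w _; exact: defect_kernel_ge0. Qed.

(** The kernel in [w] is nonnegative and lives on the countable coset of [z], so its integral
    vanishes exactly when it vanishes at each atom of that coset. *)
Let defect_eq0P z : defect z = 0 <->
  (forall b, atoms mu b -> dependent (spectrum R k) z b -> reC (c (z^-1 * b)%g) = 1).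
Proof.
rewrite /defect (Rintegral_eq0P mu mset1 (cosetC z))//; last exact: defect_kernel_off_coset.
split=> [h b mb /dependentP zb|h b mb].
  have := h b mb; rewrite /defect_kernel indicE mem_set// => /eqP.
  by rewrite subr_eq0 => /eqP.
have [zb|zb] := pselect (coset z G b); last exact: defect_kernel_off_coset.
by rewrite /defect_kernel indicE mem_set// h ?subrr//; exact/dependentP.
Qed.

Let defectE z : defect z = coset_mass z - reC (limit_kernel k cmu z).
Proof.
rewrite /defect /defect_kernel RintegralB//; first last.
- exact/bmfun_integrable/(bmfunC_limit z).1.
- exact/bmfun_integrable/bmfun_indic.
rewrite Rintegral_indic// /limit_kernel reC_conj complex_integral_probability//.
Qed.

(** A countable set off which both [coset_mass] and [defect] vanish. This gives their measurability
    and allows [Rintegral_eq0P] to be applied to the outer integral as well. *)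
Let saturation := \bigcup_(a in atoms mu) coset a G.

Let saturationP z : saturation z <-> exists2 a, atoms mu a & coset z G a.
Proof.
split=> [[a aa /dependentP az]|[a aa /dependentP za]]; exists a => //; apply/dependentP;
  by rewrite /dependent.
Qed.

Let countable_saturation : countable saturation.
Proof.
apply: bigcup_countable => [|a _]; last exact: cosetC.
by rewrite -(atoms_complex_charge mu mset1); exact: (countable_atoms mset1).
Qed.

Let coset_mass0 z : ~ saturation z -> coset_mass z = 0.
Proof.
move=> Sz; rewrite /coset_mass (probability_countable0 mset1 (cosetC z))// => a za aa.
by apply: Sz; apply/saturationP; exists a.
Qed.

Let defect0 z : ~ saturation z -> defect z = 0.
Proof.
move=> Sz; apply/defect_eq0P => b bb /dependentP zb.
by exfalso; apply: Sz; apply/saturationP; exists b.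
Qed.

Let coset_mass_le1 z : `|coset_mass z| <= 1.
Proof.
rewrite ger0_norm ?fine_ge0// -lee_fin fineK ?probability_le1//.
exact: fin_num_measure.
Qed.

Let measurable_saturation (h : T -> R) :
  (forall z, ~ saturation z -> h z = 0) -> measurable_fun setT h.
Proof.
move=> h0; have mh : measurable_funC (fun z => ofR (h z)).
  by apply: (measurable_funC_countable mset1 countable_saturation) => z /h0 ->.
exact: mh.1.
Qed.

Let coset_mass_bmfun : bmfun coset_mass.
Proof. by split; [exact: measurable_saturation|exists 1]. Qed.

Let defect_bmfun : bmfun defect.
Proof.
split; first exact: measurable_saturation.
(* The indicator is at most 1 and the real part of [c] is at least -1, so the kernel is at most 2,
   and [mu] has mass 1. *)
exists 2 => z; rewrite ger0_norm//.
have two : Rintegral mu setT (fun=> 2) = 2 :> R.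
  have -> : Rintegral mu setT (fun=> 2) = 2 * fine (mu setT) by exact: Rintegral_cst.
    by rewrite probability_setT mulr1.
rewrite -two; apply: le_Rintegral => //.
- exact/bmfun_integrable/defect_kernel_bmfun.
- exact/bmfun_integrable/bmfun_cst.
move=> w _; rewrite /defect_kernel lerBlDr.
have := le_trans (abs_reC_le _) (normR_limit_function kgood (z^-1 * w)%g).
have : \1_(coset z G) w <= 1 :> R by rewrite indicE; case: (_ \in _).
by rewrite ler_norml => ? /andP[? _]; lra.
Qed.

Let limit : R := reC (complex_integral cmu (limit_kernel k cmu)).

Let limit_kernelE : (fun z => reC (limit_kernel k cmu z)) = fun z => coset_mass z - defect z.
Proof. by apply/funext => z; rewrite defectE subKr. Qed.

Let limitE : limit = Rintegral mu setT coset_mass - Rintegral mu setT defect.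
Proof.
rewrite /limit complex_integral_probability; last first.
  have [M leM] : exists M : R, forall z, normR (limit_kernel k cmu z) <= M.
    have [B leB] := complex_integral_bounded cmu.
    exists B => z; rewrite /limit_kernel normR_conj; apply: leB.
      exact/bmfunC_measurable/bmfunC_limit.
    by move=> w; exact: normR_limit_function.
  exact: (bmfunCP (limit_kernel_measurable kgood cmu kcount) leM).
rewrite reC_mkC limit_kernelE RintegralB//.
- exact/bmfun_integrable/coset_mass_bmfun.
- exact/bmfun_integrable/defect_bmfun.
Qed.

Lemma fourier_average_probability : fourier_average cmu k @ \oo --> ofR limit.
Proof.
have cv := fourier_average_cvg kgood (mu := cmu).
suff -> : ofR limit = complex_integral cmu (limit_kernel k cmu) by [].
set I := complex_integral _ _; apply: C_eqP; first by [].
(* The averages are real, so their limit equals its own conjugate. *)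
have : I^* = I.
  apply: (cvg_unique _ (cvg_conj cv) _) => //.
  rewrite (_ : (fun _ => _) = fourier_average cmu k)//.
  apply/funext => N; rewrite -average_conj; congr average; apply/funext => n.
  by rewrite rmorphXn /= conj_Creal ?normr_real.
by move=> /(congr1 (@imC R)); rewrite imC_conj imC_ofR; lra.
Qed.

(** The function [coset_mass] is constant on each coset, so a coset contributes the square of its
    mass. By independence the cosets of points of [U] are disjoint; by maximality they contain every
    atom, hence cover [saturation]. *)
Let coset_mass_sum (U : set T) : max_independent_atoms (spectrum R k) mu U ->
  (\esum_(a in U) mu (coset a G) ^+ 2)%E = (Rintegral mu setT coset_mass)%:E.
Proof.
move=> maxU; have [[Uat Uind] _] := maxU.
have cU : countable U.
  apply: (sub_countable (subset_card_le Uat)).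
  by rewrite -(atoms_complex_charge mu mset1); exact: (countable_atoms mset1).
have [F UF] := countable_exhausts cU; have [Fm FU Fc] := UF.
have -> : (fun a => (mu (coset a G) ^+ 2)%E) = (fun a => (coset_mass a ^+ 2)%:E).
  apply/funext => a; rewrite EFin_expe /coset_mass fineK//.
  exact: fin_num_measure.
apply: (esum_exhausts UF) => [a|]; first exact: sqr_ge0.
pose f n z := \sum_(u <- F n) coset_mass u * \1_(coset u G) z.
(* At most one [u] in [F n] has [z] in its coset, and then the two cosets are equal. So [f n] is
   [coset_mass] restricted to the cosets met so far. *)
have fE n z : f n z = if `[<exists2 u, u \in F n & coset u G z>] then coset_mass z else 0.
  case: ifPn => [/asboolP[u uF uz]|/asboolPn nF].
    rewrite /f (big_fsetD1 u)//= indicE mem_set// mulr1 big1_fset ?addr0//.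
      by rewrite /coset_mass; move/dependentP: uz => ->.
    move=> v; rewrite !inE => /andP[vu vF] _; rewrite indicE memNset ?mulr0// => vz.
    apply: (Uind v u (FU _ _ vF) (FU _ _ uF)); first exact/eqP.
    by move/dependentP: uz; move/dependentP: vz; rewrite /dependent => -> ->.
  rewrite /f big1_fset// => u uF _; rewrite indicE memNset ?mulr0// => uz.
  by apply: nF; exists u.
have -> : (fun n => \sum_(x <- F n) coset_mass x ^+ 2) = (fun n => Rintegral mu setT (f n)).
  apply/funext => n; rewrite /f.
  elim: (enum_fset (F n)) => [|u s IH].
    by under eq_Rintegral do rewrite big_nil; rewrite big_nil /Rintegral integral0.
  under eq_Rintegral do rewrite big_cons.
  have bu v : bmfun (fun z => coset_mass v * \1_(coset v G) z).
    exact/bmfunZ/bmfun_indic.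
  rewrite big_cons RintegralT_D//; last first.
    elim: s {IH} => [|v s IH].
      by under eq_fun do rewrite big_nil; exact: bmfun_cst.
    by under eq_fun do rewrite big_cons; exact: bmfunD.
  rewrite IH; congr (_ + _).
  by rewrite RintegralT_Z ?Rintegral_indic ?expr2//; exact: bmfun_indic.
apply: (Rintegral_cvg (M := 1)).
- move=> n; apply: measurable_saturation => z Sz.
  by rewrite fE coset_mass0// if_same.
- by move=> n z; rewrite fE; case: ifP => // _; rewrite normr0.
- move=> z; rewrite (funext (fun n => fE n z)).
  have [Sz|Sz] := pselect (saturation z); last first.
    by rewrite coset_mass0//; under eq_fun do rewrite if_same; exact: cvg_cst.
  have [a aa /dependentP za] := (saturationP z).1 Sz.
  have [u Uu ua] := max_independent_atoms_dependent maxU aa.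
  have uz : coset u G z.
    by apply/dependentP; rewrite /dependent ua za.
  have [m um] := Fc u Uu; apply: cvg_near_cst; exists m => // n /= mn.
  by rewrite ifT//; apply/asboolP; exists u => //; exact: (fsubsetP (Fm _ _ mn)).
Qed.

(** The gap is the integral of [defect], which is nonnegative and is 0 exactly when [defect]
    vanishes at every atom. The equality condition concerns dependent pairs: for independent ones a
    b^-1 lies outside the generated group, where [c] is 0. *)
Lemma fourier_average_esum (U : set T) : max_independent_atoms (spectrum R k) mu U ->
  exists L : R,
    [/\ fourier_average cmu k @ \oo --> ofR L,
        (L%:E <= \esum_(a in U) mu (coset a G) ^+ 2)%E &
        (L%:E = \esum_(a in U) mu (coset a G) ^+ 2)%E <->
        (forall a b, atoms mu a -> atoms mu b -> dependent (spectrum R k) a b ->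
           c (a * b^-1)%g = 1)].
Proof.
move=> maxU; exists limit; rewrite coset_mass_sum// limitE.
have d0 : 0 <= Rintegral mu setT defect by apply: Rintegral_ge0 => z _; exact: defect_ge0.
split; first by rewrite -limitE; exact: fourier_average_probability.
  by rewrite lee_fin gerBl.
have -> : ((Rintegral mu setT coset_mass - Rintegral mu setT defect)%:E =
    (Rintegral mu setT coset_mass)%:E) <-> Rintegral mu setT defect = 0.
  split=> [[/eqP]|->]; last by rewrite subr0.
  by rewrite -[X in _ == X]subr0 (inj_eq (subrI _)) => /eqP.
rewrite (Rintegral_eq0P mu mset1 countable_saturation)//.
have cV a b : c (a * b^-1)%g = (c (a^-1 * b)%g)^*.
  by rewrite -(limit_functionV kgood) invgM invgK circle_mulC.
split=> [h a b aa bb ab|h a aa].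
  have := (defect_eq0P a).1 (h a aa) b bb ab; rewrite cV.
  have := normR_limit_function kgood (a^-1 * b)%g.
  move: (c _) => w w1 re1; apply: C_eqP; first by rewrite reC_conj.
  (* A number of modulus at most 1 with real part 1 has no imaginary part, so the condition on the
     real part of [c] determines [c] itself. *)
  suff w0 : imC w = 0 by rewrite imC_conj w0 oppr0.
  have := normCK w; rewrite -ofR_normR => /(congr1 (@reC R)).
  rewrite expr2 -ofRM reC_ofR reCM reC_conj imC_conj re1 => e.
  apply/eqP; rewrite -sqrf_eq0 eq_le sqr_ge0 andbT expr2.
  by have := normR_ge0 w; nra.
apply/defect_eq0P => b bb ab; have := h a b aa bb ab.
by rewrite cV => /(congr1 (@reC R)); rewrite reC_conj.
Qed.

End probability_measures.

(** * An atomless probability measure on the circle *)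

Section cayley.
Context {R : realType}.
Implicit Types t : R.

Let den_gt0 t : 0 < 1 + t ^+ 2.
Proof. by rewrite ltr_wpDr// sqr_ge0. Qed.

(** The coordinates of (1 + i t) / (1 - i t). *)
Definition cayley_val t : C R :=
  mkC ((1 - t ^+ 2) / (1 + t ^+ 2)) (2 * t / (1 + t ^+ 2)).

Lemma cayley_norm t : `|cayley_val t| = 1.
Proof.
have d0 : 1 + t ^+ 2 != 0 by rewrite gt_eqF.
rewrite normc_def /=; suff -> : ((1 - t ^+ 2) / (1 + t ^+ 2)) ^+ 2 +
  (2 * t / (1 + t ^+ 2)) ^+ 2 = 1 by rewrite sqrtr1.
by field.
Qed.

Definition cayley (t : measurableTypeR R) : circle R := circle_of (cayley_norm t).

Lemma cayley_inj : injective cayley.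
Proof.
(* The parameter is recovered as the slope of the chord joining -1 to the point. *)
have K t : imC (cayley_val t) / (1 + reC (cayley_val t)) = t.
  have d0 : 1 + t ^+ 2 != 0 by rewrite gt_eqF.
  have -> : 1 + reC (cayley_val t) = 2 / (1 + t ^+ 2) by rewrite /cayley_val /=; field.
  by rewrite /cayley_val /=; field; rewrite d0.
move=> s t /(congr1 (@circle_val R)) st.
by rewrite -(K s) -(K t); congr (imC _ / (1 + reC _)).
Qed.

Lemma cayley_continuous : continuous (cayley : R -> circle R).
Proof.
apply: continuous_comp_initial => t; apply: cvg_reim => /=.
- apply: cvgM.
    by apply: cvgB; [exact: cvg_cst|exact: exprn_continuous].
  apply: cvgV; first by rewrite gt_eqF.
  by apply: cvgD; [exact: cvg_cst|exact: exprn_continuous].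
- apply: cvgM.
    by apply: cvgM; [exact: cvg_cst|exact: cvg_id].
  apply: cvgV; first by rewrite gt_eqF.
  by apply: cvgD; [exact: cvg_cst|exact: exprn_continuous].
Qed.

Lemma cayley_measurable : measurable_fun setT cayley.
Proof.
move: cayley_continuous => /continuousP cc.
apply: (measurability (@open (circle R))) => // _ [A oA <-].
by rewrite setTI; apply: open_measurable; exact: cc.
Qed.

HB.instance Definition _ := isMeasurableFun.Build _ _ _ _ cayley cayley_measurable.

Definition cayley_uniform : probability (circle R) R :=
  distribution (uniform_prob (@ltr01 R)) cayley.

(** By injectivity the preimage of a countable set is countable, hence Lebesgue null, and the
    uniform law is dominated by Lebesgue measure. *)
Lemma cayley_uniform_countable0 (A : set (circle R)) :
  countable A -> cayley_uniform A = 0%E.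
Proof.
move=> cA; have cpA : countable (cayley @^-1` A).
  move/countable_injP: cA => [f finj]; apply/countable_injP.
  exists (f \o cayley) => s t /set_mem As /set_mem At /finj e.
  by apply: cayley_inj; apply: e; exact: mem_set.
have mA : measurable (cayley @^-1` A).
  by apply: countable_measurable cpA => x; exact: measurable_set1.
have /null_content_dominatesP dom := dominates_uniform_prob (@ltr01 R).
by apply: dom => //; exact: countable_lebesgue_measure0.
Qed.

Lemma cayley_uniform_atoms a : ~ atoms cayley_uniform a.
Proof. by move=> /eqP; apply; apply: cayley_uniform_countable0; exact: countable1. Qed.

Lemma cayley_uniform_not_discrete : ~ discrete cayley_uniform.
Proof.
move=> [A cA mA].
have mbA : measurable A.
  by apply: countable_measurable cA; exact: circle_measurable_set1.
have := probability_setC cayley_uniform mbA.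
rewrite mA cayley_uniform_countable0// sube0 => /eqP.
by rewrite eq_sym onee_eq0.
Qed.

End cayley.

Theorem theorem2p10 (R : realType) (k : nat -> nat)
  (kgood : good R k) (kcount : countable (spectrum R k)) :
  (* (a) *)
  ((forall mu : {charge set (circle R) -> \bar (C R)},
     [/\ forall l, spectrum R k l -> csummable (atoms mu) (atom_term mu l),
         csummable (spectrum R k)
           (fun l => limit_function k l * csum (atoms mu) (atom_term mu l)) &
         fourier_average mu k @ \oo -->
           csum (spectrum R k)
             (fun l => limit_function k l * csum (atoms mu) (atom_term mu l))]) /\
   (forall mu : {charge set (circle R) -> \bar (C R)},
     continuous_charge mu -> fourier_average mu k @ \oo --> (0 : C R))) /\
  (* (b) *)
  ((forall (mu : probability (circle R) R) (U : set (circle R)),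
     max_independent_atoms (spectrum R k) mu U ->
     exists L : R,
       [/\ fourier_average (complex_charge mu) k @ \oo --> ofR L,
           (L%:E <= \esum_(a in U) mu (coset a (generated (spectrum R k))) ^+ 2)%E &
           (L%:E = \esum_(a in U) mu (coset a (generated (spectrum R k))) ^+ 2)%E <->
           (forall a b, atoms mu a -> atoms mu b -> dependent (spectrum R k) a b ->
              limit_function k (a * b^-1)%g = 1)]) /\
   (exists mu : probability (circle R) R,
     (forall a b, atoms mu a -> atoms mu b -> dependent (spectrum R k) a b ->
        limit_function k (a * b^-1)%g = 1) /\
     ~ discrete mu)).
Proof.
split; [split=> mu|split=> [mu U|]].
- exact: fourier_average_csum.
- exact: fourier_average_continuous.
- exact: fourier_average_esum.
(* There are no atoms, so the equality condition holds vacuously. *)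
- exists cayley_uniform; split; last exact: cayley_uniform_not_discrete.
  by move=> a b /cayley_uniform_atoms.
Qed.
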